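(* Let $G=(V,E^+,E^-)$ be a signed graph such that $G^+=(V,E^+)$ is a circuit. Then the flow clutter $\mathcal F$ of $G$ is ideal if and only if $G$ has no odd flow-circuit strong minor $C=(V_C,E_C^+,E_C^-)$ with $|E_C^+|\ge5$.
   Context: A signed graph $G=(V,E^+,E^-)$ is a (multi)graph with edge set $E=E^+\cup E^-$ partitioned into positive and negative edges. A circuit is a cycle without repeated vertices (as an edge set); a flow is a circuit with exactly one negative edge. The flow clutter $\mathcal F$ is the family of edge sets of flows of $G$; it is ideal if the polyhedron $\{x\in\mathbb R^E: x\ge0,\ \sum_{e\in C}x_e\ge1\ \forall C\in\mathcal F\}$ is integral. A strong minor of $G$ is a signed graph obtained from $G$ by a sequence of contractions of positive edges and deletions of arbitrary edges, such that no self-loops arise. A flow-circuit is a signed graph $C=(V_C,E_C^+,E_C^-)$ on vertices $v_1,\dots,v_k$, $k\ge3$, with positive edges $v_iv_{i+1}$ ($1\le i\le k-1$) and $v_kv_1$, and negative edges $v_iv_{i+2}$ ($1\le i\le k-2$), $v_{k-1}v_1$ and $v_kv_2$; it is odd if $k$ is odd. $G$ has an odd flow-circuit strong minor $C$ if some strong minor of $G$ is isomorphic (as a signed graph) to the odd flow-circuit $C$. *)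

(* Defs.v *)
(* MathComp, with the real numbers of MathComp-Analysis *)
From HB Require Import structures.
From mathcomp Require Import all_boot all_order all_algebra.
From mathcomp Require Import classical_sets reals.

Set Implicit Arguments.
Unset Strict Implicit.
Unset Printing Implicit Defensive.

Import Order.TTheory GRing.Theory Num.Theory.

Local Open Scope ring_scope.

(* Parallel edges and self-loops are allowed. The order of the two ends of an
   edge is irrelevant: see [joins]. *)
Record sgraph := SGraph {
  vertex : finType;
  edge : finType;
  ends : edge -> vertex * vertex;
  negative : pred edge
}.

Arguments ends {s} e : rename.
Arguments negative {s} e : rename.

Definition pos_edges (G : sgraph) : {set edge G} := [set e | ~~ negative e].
Definition neg_edges (G : sgraph) : {set edge G} := [set e | negative e].

Definition joins (G : sgraph) (e : edge G) (x y : vertex G) : bool :=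
  (ends e == (x, y)) || (ends e == (y, x)).

Definition is_loop (G : sgraph) (e : edge G) : bool :=
  (ends e).1 == (ends e).2.

(* [C] is the edge set, and [A] the vertex set, of a closed walk
   v_0 e_0 v_1 e_1 ... v_(n-1) e_(n-1) v_0 without repetitions ([ordS] is the
   cyclic successor on ['I_n]). A circuit with n = 1 is a self-loop, one with
   n = 2 is a pair of parallel edges. *)
Definition circuit_on (G : sgraph) (A : {set vertex G}) (C : {set edge G}) :
    Prop :=
  exists (n : nat) (v : 'I_n -> vertex G) (e : 'I_n -> edge G),
    [/\ (0 < n)%N, injective v, injective e,
        forall i, joins (e i) (v i) (v (ordS i))
      & A = [set v i | i : 'I_n] /\ C = [set e i | i : 'I_n]].

Definition circuit (G : sgraph) (C : {set edge G}) : Prop :=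
  exists A : {set vertex G}, circuit_on A C.

(* The graph (V, E^+) is a circuit; in particular it has no isolated vertex. *)
Definition pos_circuit (G : sgraph) : Prop :=
  circuit_on [set: vertex G] (pos_edges G).

Definition flow (G : sgraph) (C : {set edge G}) : Prop :=
  circuit C /\ #|C :&: neg_edges G| = 1%N.

Definition flow_clutter (G : sgraph) : set {set edge G} := @flow G.
Arguments flow_clutter : clear implicits.

Section Ideal.
Variable R : realType.

Definition covering_polyhedron (E : finType) (F : set {set E}) :
    set {ffun E -> R} :=
  fun x => (forall e, 0 <= x e) /\
           (forall C, F C -> 1 <= \sum_(e in C) x e).

Definition extreme_point (E : finType) (P : set {ffun E -> R})
    (x : {ffun E -> R}) : Prop :=
  P x /\ forall (y z : {ffun E -> R}) (t : R), P y -> P z -> 0 < t < 1 ->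
    (forall e, x e = t * y e + (1 - t) * z e) -> y = x /\ z = x.

(* All extreme points are integral. This is the usual meaning of integrality
   for polyhedra with at least one extreme point, hence for all nonempty
   polyhedra contained in the nonnegative orthant. *)
Definition integral_polyhedron (E : finType) (P : set {ffun E -> R}) : Prop :=
  forall x, extreme_point P x -> forall e, x e \is a Num.int.

Definition ideal (E : finType) (F : set {set E}) : Prop :=
  integral_polyhedron (covering_polyhedron F).

End Ideal.

Definition delete_edge (G : sgraph) (e : edge G) : sgraph :=
  @SGraph (vertex G) {f : edge G | f != e}
    (fun f => ends (val f)) (fun f => negative (val f)).

Section Contraction.
Variables (G : sgraph) (e : edge G) (eNloop : ~~ is_loop e).

(* Identifies the second end of [e] with the first one. *)
Definition merge_ends (z : vertex G) : {z : vertex G | z != (ends e).2} :=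
  insubd (exist (fun z => z != (ends e).2) (ends e).1 eNloop) z.

Definition contract_edge : sgraph :=
  @SGraph {z : vertex G | z != (ends e).2} {f : edge G | f != e}
    (fun f => (merge_ends (ends (val f)).1, merge_ends (ends (val f)).2))
    (fun f => negative (val f)).

(* No edge other than [e] that is not a loop of [G] becomes one. *)
Definition no_loop_arises : Prop :=
  forall f : edge contract_edge, is_loop f -> is_loop (val f).

End Contraction.

Inductive strong_minor (G : sgraph) : sgraph -> Prop :=
| strong_minor_refl : strong_minor G G
| strong_minor_delete (H : sgraph) (e : edge H) :
    strong_minor G H -> strong_minor G (delete_edge e)
| strong_minor_contract (H : sgraph) (e : edge H) (eNloop : ~~ is_loop e) :
    strong_minor G H -> ~~ negative e -> no_loop_arises eNloop ->
    strong_minor G (contract_edge eNloop).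

Definition isomorphic (G H : sgraph) : Prop :=
  exists (f : vertex G -> vertex H) (g : edge G -> edge H),
    [/\ bijective f, bijective g,
        forall e x y, joins (g e) (f x) (f y) = joins e x y
      & forall e, negative (g e) = negative e].

(* Vertices are numbered from 0 and indices are read modulo k: the positive
   edge [inl i] is v_i v_(i+1) and the negative edge [inr i] is v_i v_(i+2).
   Meant for 3 <= k. *)
Definition flow_circuit (k : nat) : sgraph :=
  @SGraph 'I_k ('I_k + 'I_k)%type
    (fun e => match e with
              | inl i => (i, ordS i)
              | inr i => (i, ordS (ordS i))
              end)
    (fun e => match e with inl _ => false | inr _ => true end).

Definition has_strong_minor (G C : sgraph) : Prop :=
  exists2 H, strong_minor G H & isomorphic H C.

(* Main.v *)
(* Number the vertices v_0, v_1, ... of the positive circuit cyclically and let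
   x be an extreme point of the covering polyhedron, pos j the x-length of the
   positive walk from v_0 to v_j, and T the x-length of the circuit.  Scaling
   the positive part shows T = 0 or T >= 2.  In the second case, a negative edge
   with x = 0 that is tight joins two positions at distance exactly 1, and
   extremality says that no nontrivial displacement of the positions respects
   all these unit chords, even if T may change.  Hence a unit chord starts at
   every position modulo T, so that T = K/w in lowest terms and the positions
   are exactly the multiples of 1/w.  If w = 1 then x is integral.  If w >= 2
   then K > 2w, and cutting the circle into k arcs of equal length, with k odd,
   k >= 5, K <= k(w-1) and k(w+1) <= 3K, each arc contains the start of a unit
   chord ending two arcs later: contracting the arcs gives the odd flow-circuit.

   Conversely, a flow-circuit strong minor arises by contracting positive edges
   and deleting negative ones only.  The point that is 1/2 on the positive edges
   of the minor, 0 on the other positive edges and as small as possible on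
   negative edges is extreme: two consecutive edges of the odd circuit always
   sum to 1. *)
Require Import Defs.
From mathcomp Require Import all_boot all_order all_algebra.
From mathcomp Require Import zify ring lra.
From mathcomp Require Import boolp classical_sets reals.

Set Implicit Arguments.
Unset Strict Implicit.
Unset Printing Implicit Defensive.

Import Order.TTheory GRing.Theory Num.Theory.

(** * Circuits, cuts and arcs *)

Lemma joinsC (G : sgraph) (f : edge G) x y : joins f x y = joins f y x.
Proof. by rewrite /joins orbC. Qed.

Lemma joins_ends (G : sgraph) (f : edge G) : joins f (ends f).1 (ends f).2.
Proof. by rewrite /joins -surjective_pairing eqxx. Qed.

Lemma joins_endsP (G : sgraph) (f : edge G) x y :
  reflect (((ends f).1 = x /\ (ends f).2 = y) \/
           ((ends f).1 = y /\ (ends f).2 = x)) (joins f x y).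
Proof.
rewrite /joins; case: (ends f) => a b /=; rewrite !xpair_eqE.
apply: (iffP orP) => -[] => [/andP[/eqP ? /eqP ?]|/andP[/eqP ? /eqP ?]|[-> ->]|[-> ->]];
  by [left | right | left; rewrite !eqxx | right; rewrite !eqxx].
Qed.

Lemma joins_pair (G : sgraph) (f : edge G) x y x' y' :
  joins f x y -> joins f x' y' -> x = x' /\ y = y' \/ x = y' /\ y = x'.
Proof.
by move=> /joins_endsP[[<- <-]|[<- <-]] /joins_endsP[[<- <-]|[<- <-]]; auto.
Qed.

Definition crosses (G : sgraph) (phi : vertex G -> bool) (f : edge G) : bool :=
  phi (ends f).1 (+) phi (ends f).2.

Lemma crosses_joins (G : sgraph) (phi : vertex G -> bool) (f : edge G) x y :
  joins f x y -> crosses phi f = phi x (+) phi y.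
Proof. by rewrite /crosses => /joins_endsP[[-> ->]|[-> ->]] //; rewrite addbC. Qed.

(** Around a closed walk the colour changes cancel modulo 2, so no cut meets a circuit in exactly
    one edge. *)
Lemma circuit_crosses_twice (G : sgraph) (C : {set edge G})
    (phi : vertex G -> bool) (f : edge G) :
  circuit C -> f \in C -> crosses phi f ->
  exists2 f', f' \in C & f' != f /\ crosses phi f'.
Proof.
move=> [A [m [v [e [m_gt0 v_inj e_inj e_joins [_ ->]]]]]] /imsetP[i0 _ ->] cr0.
have sum0 : \big[addb/false]_(i < m) crosses phi (e i) = false.
  under eq_bigr => i _ do rewrite (crosses_joins phi (e_joins i)).
  rewrite big_split /=.
  rewrite -(reindex_inj (h := @ordS m) (P := xpredT) (F := fun i => phi (v i))) /=;
    last exact: ordS_inj.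
  exact: addbb.
have [j /andP[jNi crj]|none] := pickP (fun j => (j != i0) && crosses phi (e j)).
  exists (e j); first exact: imset_f.
  by split=> //; rewrite (inj_eq e_inj).
move: sum0; rewrite (bigD1 i0) //= cr0 big1 // => i iNi.
by have := none i; rewrite iNi.
Qed.

(* Indices of vertices and edges are read modulo [n], so that the arcs of the
   circuit are the intervals of [nat]. *)
Record pos_cycle (G : sgraph) (n : nat) (v : nat -> vertex G)
    (e : nat -> edge G) : Prop := PosCycle {
  pc_gt0 : 0 < n;
  pc_v : forall i j, (v i == v j) = (i == j %[mod n]);
  pc_e : forall i j, (e i == e j) = (i == j %[mod n]);
  pc_joins : forall i, joins (e i) (v i) (v i.+1);
  pc_v_surj : forall u, exists2 i, i < n & v i = u;
  pc_e_surj : forall f, ~~ negative f -> exists2 i, i < n & e i = f;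
  pc_e_pos : forall i, ~~ negative (e i) }.

Lemma pos_circuitP (G : sgraph) :
  pos_circuit G -> exists n v e, @pos_cycle G n v e.
Proof.
move=> [n [v [e [n_gt0 v_inj e_inj e_joins [VE CE]]]]].
pose o i : 'I_n := Ordinal (ltn_pmod i n_gt0).
have oS i : o i.+1 = ordS (o i).
  by apply: val_inj; rewrite /= -[i.+1]addn1 -[(i %% n).+1]addn1 modnDml.
have o_eq i j : (o i == o j) = (i == j %[mod n]) by [].
have oK (i : 'I_n) : o i = i by apply: val_inj; rewrite /= modn_small.
exists n, (v \o o), (e \o o); split=> //=.
- by move=> i j; rewrite (inj_eq v_inj).
- by move=> i j; rewrite (inj_eq e_inj).
- by move=> i; rewrite oS.
- move=> u; have : u \in [set: vertex G] by rewrite inE.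
  by rewrite VE => /imsetP[i _ ->]; exists i; rewrite ?oK.
- move=> f fpos; have : f \in pos_edges G by rewrite inE.
  by rewrite CE => /imsetP[i _ ->]; exists i; rewrite ?oK.
- move=> i; have : e (o i) \in pos_edges G by rewrite CE imset_f.
  by rewrite inE.
Qed.

Section PosCycle.
Variables (G : sgraph) (n : nat) (v : nat -> vertex G) (e : nat -> edge G).
Hypothesis vP : pos_cycle n v e.

Lemma pc_vD i : v (i + n) = v i.
Proof. by apply/eqP; rewrite (pc_v vP) modnDr. Qed.

Lemma pc_window a u : exists2 j, a <= j < a + n & v j = u.
Proof.
have n_gt0 := pc_gt0 vP.
have [i _ <-] := pc_v_surj vP u.
exists (a + (i + (n - a %% n)) %% n).
  by have := ltn_pmod (i + (n - a %% n)) n_gt0; lia.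
apply/eqP; rewrite (pc_v vP) modnDmr addnCA.
have -> : a + (n - a %% n) = (a %/ n).+1 * n.
  by have := ltn_pmod a n_gt0; rewrite {1}(divn_eq a n) mulSn; lia.
by rewrite addnC modnMDl.
Qed.

Lemma eq_mod_window i j a : a <= i < a + n -> a <= j < a + n ->
  i = j %[mod n] -> i = j.
Proof.
move=> ia ja; wlog ij : i j ia ja / i <= j => [hw|] eqij.
  by case/orP: (leq_total i j) => ?; [|symmetry]; apply: hw.
have /eqP := esym eqij; rewrite (eqn_mod_dvd _ ij) => /dvdnP[[|q]]; rewrite ?mulSn; lia.
Qed.

Lemma pc_e_window a f : ~~ negative f -> exists2 j, a <= j < a + n & e j = f.
Proof.
move=> fpos; have [i _ <-] := pc_e_surj vP fpos.
have [j aj /eqP] := pc_window a (v i).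
by rewrite (pc_v vP) => ij; exists j => //; apply/eqP; rewrite (pc_e vP).
Qed.

(** Containing one of the two arcs between the ends of its negative edge is what matters of a flow:
    weights are nonnegative, so the arc constraints imply those of all flows. *)
Lemma flow_arc (C : {set edge G}) : flow C ->
  exists f s t, [/\ negative f, f \in C, joins f (v s) (v t), s <= t <= s + n
    & forall i, s <= i < t -> e i \in C].
Proof.
move=> [Ccirc /eqP/cards1P[f Cf]].
have /setIP[fC] : f \in C :&: neg_edges G by rewrite Cf set11.
rewrite inE => fneg.
have Cpos g : g \in C -> g != f -> ~~ negative g.
  move=> gC; apply: contraNN => gneg.
  have : g \in C :&: neg_edges G by rewrite !inE gC.
  by rewrite Cf inE.
have n_gt0 := pc_gt0 vP.
have [a [b [a_lt_n ab fab]]] :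
    exists a b, [/\ a < n, a <= b < a + n & joins f (v a) (v b)].
  have [a a_lt va] := pc_v_surj vP (ends f).1.
  have [b ab vb] := pc_window a (ends f).2.
  by exists a, b; rewrite va vb; split=> //; apply: joins_ends.
have [all_ab|] := boolP (all (fun i => e i \in C) (iota a (b - a))).
  exists f, a, b; split=> //; first lia.
  by move=> i i_ab; apply: (allP all_ab); rewrite mem_iota; lia.
case/allPn=> i0; rewrite mem_iota => i0_ab i0C.
(* If [e i0] and [e i1] are missing, one on each arc, then [f] is the only edge
   of [C] across the cut they define. *)
exists f, b, (a + n); split=> //; first by rewrite pc_vD joinsC.
  by lia.
move=> i1 i1_ba; apply: contraT => i1C.
pose phi u := has (fun j => v j == u) (iota i0.+1 (i1 - i0)).
have phiE j : a <= j <= a + n -> phi (v j) = (i0 < j <= i1).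
  move=> j_an; apply/hasP/idP => [[k]|j_i01]; last first.
    by exists j => //; rewrite mem_iota; lia.
  rewrite mem_iota => k_i01; rewrite (pc_v vP) => /eqP kj.
  have [j_lt|] := ltnP j (a + n).
    by rewrite -(@eq_mod_window k j a) //; lia.
  (* The window is closed on the right, and [v (a + n)] is [v a], which lies outside the arc because
     [a <= i0]. *)
  move=> j_ge; have jE : j = a + n by lia.
  move: kj; rewrite jE modnDr => kj.
  have := @eq_mod_window k a a _ _ kj; lia.
have [|g gC [gNf]] := @circuit_crosses_twice G C phi f Ccirc fC.
  by rewrite (crosses_joins phi fab) !phiE; lia.
have [j j_an eg] := pc_e_window a (Cpos g gC gNf).
rewrite -eg (crosses_joins phi (pc_joins vP j)) !phiE; [|lia|lia].
move=> cr; have [jE|jE] : j = i0 \/ j = i1 by lia.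
  by move: i0C; rewrite -jE eg gC.
by move: i1C; rewrite -jE eg gC.
Qed.

(** The bound [l < n] keeps the [l + 1] vertices of the arc distinct; [f] closes the walk along
    it. *)
Lemma arc_flow f s l : negative f -> l < n -> joins f (v s) (v (s + l)) ->
  flow (f |: [set e (s + i) | i : 'I_l]).
Proof.
move=> fneg l_lt_n fj; split; last first.
  rewrite (_ : _ :&: _ = [set f]) ?cards1 //; apply/setP => g.
  rewrite !inE; case: eqP => [->|_] /=; first by rewrite fneg.
  apply/negP => /andP[/imsetP[i _ ->]]; exact/negP/(pc_e_pos vP).
have n_gt0 := pc_gt0 vP.
pose v' (i : 'I_l.+1) := v (s + i).
pose e' (i : 'I_l.+1) := if i < l then e (s + i) else f.
have eNf i : e i != f by apply: contraTneq fneg => <-; exact: (pc_e_pos vP).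
exists [set v' i | i : 'I_l.+1], l.+1, v', e'; split=> //.
- move=> i j /eqP; rewrite /v' (pc_v vP) => /eqP ij.
  apply: val_inj; apply: (@addnI s).
  by apply: (@eq_mod_window _ _ s _ _ ij); have := ltn_ord i; have := ltn_ord j; lia.
- move=> i j; rewrite /e'; case: ltnP => il; case: ltnP => jl.
  + move=> /eqP; rewrite (pc_e vP) => /eqP ij.
    apply: val_inj; apply: (@addnI s).
    by apply: (@eq_mod_window _ _ s _ _ ij); lia.
  + by move/eqP; rewrite (negPf (eNf _)).
  + by move/eqP; rewrite eq_sym (negPf (eNf _)).
  + by move=> _; apply: val_inj => /=; have := ltn_ord i; have := ltn_ord j; lia.
- move=> i; rewrite /e' /v'; case: ltnP => il /=.
    by rewrite modn_small ?ltnS // addnS; exact: (pc_joins vP).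
  have -> : val i = l by have := ltn_ord i; rewrite /=; lia.
  by rewrite modnn addn0 joinsC.
- split=> //; apply/setP => g; rewrite !inE; apply/orP/imsetP.
    move=> [/eqP->|/imsetP[i _ ->]].
      by exists ord_max => //; rewrite /e' /= ltnn.
    by exists (widen_ord (leqnSn l) i) => //; rewrite /e' /= ltn_ord.
  move=> [i _ ->]; rewrite /e'; case: ltnP => il; last by left.
  by right; apply/imsetP; exists (Ordinal il).
Qed.

End PosCycle.

(** * Constraints as arc lengths *)

Section ArcLength.
Variables (R : realType) (G : sgraph) (n : nat).
Variables (v : nat -> vertex G) (e : nat -> edge G).
Hypothesis vP : pos_cycle n v e.
Local Open Scope ring_scope.
Implicit Types (d : edge G -> R) (x : {ffun edge G -> R}) (C : {set edge G}).

Definition arc_len d s t : R := \sum_(s <= i < t) d (e i).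

Lemma arc_len_cat d s t u : (s <= t <= u)%N ->
  arc_len d s u = arc_len d s t + arc_len d t u.
Proof. by move=> /andP[st tu]; rewrite /arc_len (big_cat_nat st tu). Qed.

Lemma arc_len_mod d s s' l : s = s' %[mod n] ->
  arc_len d s (s + l) = arc_len d s' (s' + l).
Proof.
move=> ss'; rewrite /arc_len -[X in \sum_(X <= _ < _) _]add0n big_addn addKn.
rewrite -[X in _ = \sum_(X <= _ < _) _]add0n big_addn addKn.
apply: eq_bigr => i _; congr d; apply/eqP.
by rewrite (pc_e vP) -modnDmr ss' modnDmr.
Qed.

Lemma arc_len_ge0 d s t : (forall g, 0 <= d g) -> 0 <= arc_len d s t.
Proof. by move=> d_ge0; apply: sumr_ge0. Qed.

Definition arc_set f s t : {set edge G} :=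
  f |: [set e (s + i) | i : 'I_(t - s)].

Lemma sum_arc_set d f s t : negative f -> (s <= t <= s + n)%N ->
  \sum_(g in arc_set f s t) d g = d f + arc_len d s t.
Proof.
move=> fneg st; rewrite /arc_set big_setU1 /=; last first.
  apply/imsetP => -[i _ fE]; move: fneg; rewrite fE.
  exact/negP/(pc_e_pos vP).
congr (_ + _); rewrite big_imset /=; last first.
  move=> i j _ _ /eqP; rewrite (pc_e vP) => /eqP ij.
  apply: val_inj; apply: (@addnI s); apply: (@eq_mod_window _ _ _ s _ _ ij).
    by have := ltn_ord i; lia.
  by have := ltn_ord j; lia.
rewrite /arc_len -[X in \sum_(X <= _ < _) _]add0n big_addn big_mkord.
by apply: eq_big => i //; rewrite addnC.
Qed.

(** The walk from [s] to [t] may turn several times; dropping full turns leaves an arc shorter than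
    the circuit, and what is dropped has nonnegative length. *)
Lemma covering_arc x f s t : covering_polyhedron (flow_clutter G) x ->
  negative f -> (s <= t)%N -> joins f (v s) (v t) -> 1 <= x f + arc_len x s t.
Proof.
move=> [x_ge0 x_cov] fneg st fj; have n_gt0 := pc_gt0 vP.
have l_lt_n : ((t - s) %% n < n)%N by rewrite ltn_pmod.
set l := ((t - s) %% n)%N in l_lt_n.
have slt : (s + l <= t)%N by have := leq_mod (t - s) n; rewrite -/l; lia.
have fj' : joins f (v s) (v (s + l)).
  rewrite (_ : v (s + l) = v t) //; apply/eqP.
  by rewrite (pc_v vP) modnDmr subnKC.
have := x_cov _ (arc_flow vP fneg l_lt_n fj').
have := @sum_arc_set x f s (s + l) fneg.
rewrite /arc_set addKn => ->; last by rewrite leq_addr leq_add2l ltnW.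
move=> /le_trans; apply; rewrite lerD2l (@arc_len_cat _ s (s + l) t) ?leq_addr //.
by rewrite lerDl arc_len_ge0.
Qed.

Lemma flow_sum C : flow C -> exists f s t,
  [/\ negative f, joins f (v s) (v t), (s <= t <= s + n)%N
   & forall d, \sum_(g in C) d g =
       d f + arc_len d s t + \sum_(g in C :\: arc_set f s t) d g].
Proof.
move=> Cflow; have [f [s [t [fneg fC fj st stC]]]] := flow_arc vP Cflow.
exists f, s, t; split=> // d; rewrite -sum_arc_set //.
have sub : arc_set f s t \subset C.
  apply/fintype.subsetP => g; rewrite !inE => /orP[/eqP->//|/imsetP[i _ ->]].
  by apply: stC; have := ltn_ord i; lia.
by rewrite (big_setID (arc_set f s t)) /= (finset.setIidPr sub).
Qed.

(** By [covering_arc] the edge [f] and its arc already weigh at least 1, so the rest of a tight flow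
    has weight 0 and is invisible to every [d] that vanishes where [x] does. *)
Lemma tight_flow x C : covering_polyhedron (flow_clutter G) x ->
  flow C -> \sum_(g in C) x g = 1 ->
  exists f s t, [/\ negative f, joins f (v s) (v t), (s <= t <= s + n)%N,
     x f + arc_len x s t = 1
   & forall d, (forall g, x g = 0 -> d g = 0) ->
       \sum_(g in C) d g = d f + arc_len d s t].
Proof.
move=> xP /flow_sum[f [s [t [fneg fj st sumE]]]]; rewrite sumE => x1.
have := covering_arc xP fneg (proj1 (andP st)) fj.
have x_ge0 := xP.1.
have : 0 <= \sum_(g in C :\: arc_set f s t) x g by rewrite sumr_ge0.
set r := \sum_(g in _) x g in x1 *; move=> r_ge0 a_ge1.
have r0 : r = 0 by lra.
exists f, s, t; split=> //; first lra.
move=> d xd; rewrite sumE [X in _ + X]big1 ?addr0 // => g gC.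
by apply: xd; apply: (psumr_eq0P _ r0).
Qed.

End ArcLength.

(** * Perturbation of extreme points *)

Section Rigidity.
Variables (R : realType) (E : finType) (F : set {set E}).
Local Open Scope ring_scope.

(** Here [a] holds the slacks of constraints and [b] their changes; as they are finitely many, one
    step length serves them all. *)
Lemma small_scale (I : finType) (P : pred I) (a b : I -> R) :
  (forall i, P i -> 0 <= a i) -> (forall i, P i -> a i = 0 -> b i = 0) ->
  exists2 h : R, 0 < h & forall i, P i -> `|h * b i| <= a i.
Proof.
move=> a_ge0 ab.
suff [h h_gt0 hb] : exists2 h : R, 0 < h &
    forall i, i \in enum P -> `|h * b i| <= a i.
  by exists h => // i Pi; apply: hb; rewrite mem_enum.
have : all P (enum P) by apply/allP => i; rewrite mem_enum.
elim: (enum P) => [|i r IH] /=; first by exists 1.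
move=> /andP[Pi /IH[h h_gt0 hb]].
have [k k_gt0 kb] : exists2 k : R, 0 < k & k * `|b i| <= a i.
  have [a0|aN0] := eqVneq (a i) 0.
    by exists 1 => //; rewrite ab // normr0 mulr0 a0.
  have a_gt0 : 0 < a i by rewrite lt_def aN0 a_ge0.
  have b1_gt0 : 0 < `|b i| + 1 by rewrite ltr_wpDl.
  exists (a i / (`|b i| + 1)); first exact: divr_gt0.
  by rewrite mulrAC ler_pdivrMr // ler_pM2l // lerDl.
exists (Num.min h k); first by rewrite lt_min h_gt0.
have m_gt0 : 0 < Num.min h k by rewrite lt_min h_gt0.
move=> j; rewrite inE normrM (gtr0_norm m_gt0) => /orP[/eqP->|/hb].
  by apply: le_trans kb; rewrite ler_wpM2r // ge_min lexx orbT.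
rewrite normrM (gtr0_norm h_gt0); apply: le_trans.
by rewrite ler_wpM2r // ge_min lexx.
Qed.

(** Otherwise a short step along [d] and one along [-d] both stay in the polyhedron, with [x] as
    their midpoint. *)
Lemma extreme_point_rigid (x : {ffun E -> R}) (d : E -> R) :
  extreme_point (covering_polyhedron F) x ->
  (forall g, x g = 0 -> d g = 0) ->
  (forall C, F C -> \sum_(g in C) x g = 1 -> \sum_(g in C) d g = 0) ->
  forall g, d g = 0.
Proof.
move=> [[x_ge0 x_cov] x_ext] d0 dC g.
have [h1 h1_gt0 h1P] : exists2 h : R, 0 < h & forall g, predT g -> `|h * d g| <= x g.
  by apply: small_scale => i _ //; exact: d0.
have [h2 h2_gt0 h2P] : exists2 h : R, 0 < h &
    forall C : {set E}, `[< F C >] -> `|h * (\sum_(g in C) d g)| <= \sum_(g in C) x g - 1.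
  apply: small_scale => C /asboolP FC; first by rewrite subr_ge0 x_cov.
  by move=> /subr0_eq; exact: dC.
set h := Num.min h1 h2.
have h_gt0 : 0 < h by rewrite lt_min h1_gt0.
have feas (s : R) : `|s| = h ->
    covering_polyhedron F [ffun g => x g + s * d g].
  move=> sh; split=> [g'|C FC].
    rewrite ffunE; have := h1P g' isT.
    have : `|s * d g'| <= `|h1 * d g'|.
      rewrite !normrM sh (gtr0_norm h1_gt0) ler_wpM2r //.
      by rewrite ge_min lexx.
    by move: (s * d g') => a; rewrite ler_norml => h3 h4; lra.
  under eq_bigr => g' _ do rewrite ffunE.
  rewrite big_split /= -mulr_sumr.
  have := h2P C (asboolT FC).
  have : `|s * (\sum_(g in C) d g)| <= `|h2 * (\sum_(g in C) d g)|.
    rewrite !normrM sh (gtr0_norm h2_gt0) ler_wpM2r //.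
    by rewrite ge_min lexx orbT.
  by move: (s * _) => a; rewrite ler_norml => h3 h4; lra.
have half : 0 < (2^-1 : R) < 1.
  by apply/andP; split; lra.
have [|y_eq _] := x_ext _ _ _ (feas h (gtr0_norm h_gt0))
    (feas (- h) (etrans (normrN _) (gtr0_norm h_gt0))) half.
  by move=> g'; rewrite !ffunE; lra.
have /eqP := congr1 (fun z : {ffun E -> R} => z g) y_eq.
rewrite ffunE addrC -subr_eq0 addrK mulf_eq0 => /orP[/eqP h0|/eqP//].
by rewrite h0 ltxx in h_gt0.
Qed.

End Rigidity.

(** * Extreme points *)

Lemma quasiperiodicM (R : pzRingType) (n : nat) (delta : nat -> R) (D : R) :
  (forall j, delta (j + n)%N = delta j + D)%R ->
  forall j q, (delta (j + q * n)%N = delta j + q%:R * D)%R.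
Proof.
move=> dD j; elim=> [|q IH]; first by rewrite mul0n addn0 mul0r addr0.
by rewrite mulSn addnCA addnC dD IH -natr1 mulrDl mul1r addrA.
Qed.

Section ExtremePoint.
Variables (R : realType) (G : sgraph) (n : nat).
Variables (v : nat -> vertex G) (e : nat -> edge G).
Hypothesis vP : pos_cycle n v e.
Variable x : {ffun edge G -> R}.
Hypothesis x_ext : extreme_point (covering_polyhedron (flow_clutter G)) x.
Local Open Scope ring_scope.

Local Notation len := (arc_len e).
Let pos j := len x 0 j.
Let T := pos n.

Lemma extreme_covering : covering_polyhedron (flow_clutter G) x.
Proof. exact: x_ext.1. Qed.

Lemma extreme_ge0 g : 0 <= x g.
Proof. exact: extreme_covering.1. Qed.

Lemma arc_len_pos s t : (s <= t)%N -> len x s t = pos t - pos s.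
Proof. by move=> st; rewrite /pos (@arc_len_cat _ _ _ _ 0%N s t) //= addrC addKr. Qed.

Lemma posS j : pos j.+1 = pos j + x (e j).
Proof. by rewrite /pos /arc_len big_nat_recr. Qed.

Lemma pos0 : pos 0 = 0.
Proof. by rewrite /pos /arc_len big_geq. Qed.

Lemma pos_mono s t : (s <= t)%N -> pos s <= pos t.
Proof.
by move=> st; rewrite -subr_ge0 -arc_len_pos //; apply: arc_len_ge0; apply: extreme_ge0.
Qed.

Lemma posD j : pos (j + n) = pos j + T.
Proof.
have n0 : n = 0 %[mod n] by rewrite modnn mod0n.
have := arc_len_mod vP x j n0; rewrite add0n -/(pos j) => <-.
rewrite addrC /T /pos (@arc_len_cat _ _ _ _ 0%N n) ?leq_addl //.
by rewrite [(n + j)%N]addnC.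
Qed.

Lemma posM j q : pos (j + q * n) = pos j + q%:R * T.
Proof. exact: quasiperiodicM posD _ _. Qed.

Definition tight f s t :=
  [/\ negative f, joins f (v s) (v t), (s <= t <= s + n)%N & x f + len x s t = 1].

(* [delta j] is a displacement of the [j]-th vertex along the circle, and [D] the
   resulting change of [T]. *)
Lemma cycle_rigid (delta : nat -> R) (D : R) :
  (forall j, delta (j + n)%N = delta j + D) ->
  (forall j, x (e j) = 0 -> delta j.+1 = delta j) ->
  (forall f s t, tight f s t -> x f = 0 -> delta t = delta s) ->
  (forall f s t s' t', tight f s t -> tight f s' t' ->
     delta t - delta s = delta t' - delta s') ->
  forall j, delta j = delta 0%N.
Proof.
move=> dD d0 dt0 dtt.
have dM := quasiperiodicM dD.
(* The displacement becomes a direction on edges: the change of length on a positive edge, minus the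
   change along a tight arc on a negative edge (independent of the arc by the last hypothesis), and
   0 on negative edges without tight arc. *)
have /choice[d dP] : forall g, exists r : R,
    [/\ x g = 0 -> r = 0,
        forall s t, tight g s t -> r = - (delta t - delta s)
      & forall j, e j = g -> r = delta j.+1 - delta j].
  move=> g; have [gneg|gpos] := boolP (negative g).
    have eNg j : e j <> g by move=> eg; have := pc_e_pos vP j; rewrite eg gneg.
    have [[s [t st]]|no] := pselect (exists s t, tight g s t).
      exists (- (delta t - delta s)); split=> //.
      - by move=> xg0; rewrite (dt0 _ _ _ st xg0) subrr oppr0.
      - by move=> s' t' st'; rewrite (dtt _ _ _ _ _ st st').
      - by move=> j /eNg.
    by exists 0; split=> // [s t st|j /eNg//]; case: no; exists s, t.
  have [i i_lt eig] := pc_e_surj vP gpos.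
  exists (delta i.+1 - delta i); split=> //.
  - by rewrite -eig => /d0 ->; rewrite subrr.
  - by move=> s t [gneg]; rewrite gneg in gpos.
  - move=> j /eqP; rewrite -eig (pc_e vP) => /eqP ij.
    rewrite (divn_eq j n) ij modn_small // addnC -addSn !dM.
    by rewrite opprD addrACA subrr addr0.
have lend s t : (s <= t)%N -> len d s t = delta t - delta s.
  move=> st; rewrite /arc_len.
  under eq_bigr => i _ do rewrite (let: And3 _ _ h := dP (e i) in h i erefl).
  exact: telescope_sumr.
have d_0 : forall g, d g = 0.
  apply: (extreme_point_rigid x_ext) => [g|C Cflow C1]; first by case: (dP g).
  have [f [s [t [fneg fj st x1 sumE]]]] := tight_flow vP extreme_covering Cflow C1.
  rewrite sumE; last by move=> g; case: (dP g).
  rewrite lend; last by case/andP: st.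
  have [_ h _] := dP f; rewrite (h s t) ?addNr //.
elim=> // j <-; apply/eqP; rewrite -subr_eq0.
by have [_ _ h] := dP (e j); rewrite -(h j erefl) d_0.
Qed.

(** If [f] had no tight arc, its nonzero coordinate could be moved alone. *)
Lemma negative_tight f : negative f -> x f != 0 -> exists s t, tight f s t.
Proof.
move=> fneg xf; apply: contrapT => no.
pose d g : R := (g == f)%:R.
have : d f = 0.
  apply: (extreme_point_rigid x_ext) => [g xg0|C Cflow C1].
    by rewrite /d; case: eqP => // gf; rewrite -gf xg0 eqxx in xf.
  have [f' [s [t [f'neg fj st x1 sumE]]]] := tight_flow vP extreme_covering Cflow C1.
  rewrite sumE; last first.
    by move=> g xg0; rewrite /d; case: eqP => // gf; rewrite -gf xg0 eqxx in xf.
  rewrite /arc_len big1 ?addr0 => [|i _]; last first.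
    rewrite /d; case: eqP => // ef.
    by have := pc_e_pos vP i; rewrite ef fneg.
  rewrite /d; case: eqP => // ff'; case: no; exists s, t.
  by rewrite -ff'.
by move/eqP; rewrite /d eqxx oner_eq0.
Qed.

Lemma integral_of_positive : (forall j, x (e j) \is a Num.int) ->
  forall g, x g \is a Num.int.
Proof.
move=> xe_int g; have [gneg|gpos] := boolP (negative g); last first.
  by have [i _ <-] := pc_e_surj vP gpos.
have [->|xg] := eqVneq (x g) 0; first exact: rpred0.
have [s [t [_ _ _ x1]]] := negative_tight gneg xg.
have -> : x g = 1 - len x s t by rewrite -x1 addrK.
by rewrite rpredB ?rpred1 // rpred_sum.
Qed.

(** The displacement [pos] scales all positive weights. When [T < 2] nothing obstructs it, and
    rigidity gives [T = pos 0]. *)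
Lemma total_eq0_or_ge2 : T = 0 \/ 2 <= T.
Proof.
have [T2|T2] := leP 2 T; [by right | left].
rewrite /T -[RHS]pos0; apply: (@cycle_rigid pos T) => // [j||f s t|f s t s' t'].
- exact: posD.
- by move=> j xj0; rewrite posS xj0 addr0.
(* The arc has length 1, so the complementary arc has length [T - 1 < 1], which violates its
   covering constraint. *)
- move=> [fneg fj st x1] xf0; exfalso.
  have := covering_arc (s := t) (t := (s + n)%N) vP extreme_covering fneg _ _.
  case/andP: st => st1 st2 /(_ st2).
  rewrite (pc_vD vP) joinsC => /(_ fj).
  rewrite arc_len_pos // posD; move: x1; rewrite arc_len_pos // xf0 => x1.
  by move: x1 T2; clear; lra.
- move=> [_ _ /andP[st _] x1] [_ _ /andP[st' _] x1'].
  by rewrite !arc_len_pos // in x1 x1'; lra.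
Qed.

(** The case of interest is a tight arc whose negative edge has weight 0. *)
Definition chord s t :=
  exists f, [/\ negative f, joins f (v s) (v t), (s <= t)%N & pos t = pos s + 1].

(** For [T >= 2], two tight arcs of an edge with positive weight differ only by full turns, so
    rigidity has to be tested on chords only. *)
Lemma chord_rigid (delta : nat -> R) (D : R) : 2 <= T ->
  (forall j, delta (j + n)%N = delta j + D) ->
  (forall j, pos j.+1 = pos j -> delta j.+1 = delta j) ->
  (forall s t, chord s t -> delta t = delta s) ->
  forall j, delta j = delta 0%N.
Proof.
move=> T2 dD d0 dc; have n_gt0 := pc_gt0 vP.
have tight_chord f s t : tight f s t -> x f = 0 -> delta t = delta s.
  move=> [fneg fj /andP[st _] x1] xf0; apply: dc; exists f; split=> //.
  by rewrite arc_len_pos // xf0 in x1; lra.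
apply: (@cycle_rigid delta D) => //.
  by move=> j xj0; apply: d0; rewrite posS xj0 addr0.
move=> f s t s' t' tst tst'.
have [xf0|xf0] := eqVneq (x f) 0.
  by rewrite (tight_chord f s t) // (tight_chord f s' t') // !subrr.
have xf_gt0 : 0 < x f by rewrite lt_def xf0 extreme_ge0.
case: tst tst' => [fneg fj /andP[st1 st2] x1] [_ fj' /andP[st1' st2'] x1'].
rewrite !arc_len_pos // in x1 x1'.
(* A full turn has length [T >= 2], more than the tight arc of length [1 - x f]. *)
have tn : (t < s + n)%N.
  rewrite ltn_neqAle st2 andbT; apply/eqP => tE.
  by move: x1; rewrite tE posD; lra.
have tn' : (t' < s' + n)%N.
  rewrite ltn_neqAle st2' andbT; apply/eqP => tE.
  by move: x1'; rewrite tE posD; lra.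
have dM := quasiperiodicM dD.
have [[vs vt]|[vs vt]] := joins_pair fj fj'.
- move: vs vt => /eqP; rewrite (pc_v vP) => /eqP ss /eqP.
  rewrite (pc_v vP) => /eqP tt.
  wlog le_ss : s s' t t' st1 st2 st1' st2' fj fj' x1 x1' tn tn' ss tt /
      (s <= s')%N => [hw|].
    case/orP: (leq_total s s') => le_ss; first by apply: hw.
    by symmetry; apply: hw.
  have /eqP := esym ss; rewrite (eqn_mod_dvd _ le_ss) => /dvdnP[q qE].
  have s'E : s' = (s + q * n)%N by lia.
  have t'E : t' = (t + q * n)%N.
    apply: (@eq_mod_window n _ _ s') => //; first lia.
      by lia.
    by rewrite addnC modnMDl.
  by rewrite s'E t'E !dM opprD addrACA subrr addr0.
- move: vs vt => /eqP; rewrite (pc_v vP) => /eqP st' /eqP.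
  rewrite (pc_v vP) => /eqP ts'.
  have [sE|sNt] := eqVneq s t.
    suff -> : t' = s' by rewrite sE !subrr.
    by apply: (@eq_mod_window n _ _ s'); [lia | lia | rewrite -st' sE ts'].
  exfalso.
  (* Opposite arcs of the same edge would make up a full turn, of length [2 * (1 - x f) < 2]. *)
  have uE : (t + (t' - s') = s + n)%N.
    apply: (@eq_mod_window n _ _ t); [lia | lia |].
    by rewrite -modnDml ts' modnDml subnKC // -st' modnDr.
  have := arc_len_mod vP x (t' - s') ts'.
  rewrite uE subnKC // !arc_len_pos // posD; lra.
Qed.


(** * Unit chords and positions modulo [T] *)

Definition modT a b := exists z : int, a = b + z%:~R * T.

Lemma modT_refl a : modT a a.
Proof. by exists 0; rewrite mul0r addr0. Qed.

Lemma modT_sym a b : modT a b -> modT b a.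
Proof. by move=> [z ->]; exists (- z); rewrite rmorphN mulNr addrK. Qed.

Lemma modT_trans a b c : modT a b -> modT b c -> modT a c.
Proof.
by move=> [z ->] [z' ->]; exists (z' + z); rewrite rmorphD mulrDl addrA.
Qed.

Definition chord_start p := exists s t, chord s t /\ modT (pos s) p.

(** The indicator of [A] is a displacement with [D = 0]; rigidity makes it constant. *)
Lemma chord_invariant (A : R -> Prop) : 2 <= T ->
  (forall p, A p <-> A (p + T)) ->
  (forall s t, chord s t -> (A (pos s) <-> A (pos t))) ->
  forall i j, A (pos i) -> A (pos j).
Proof.
move=> T2 AT Ac i j; pose delta j : R := `[< A (pos j) >]%:R.
have dE : forall j, delta j = delta 0%N.
  apply: (@chord_rigid delta 0) => // [k|k posk|s t st].
  - by rewrite addr0 /delta posD; congr ((nat_of_bool _)%:R); apply/esym/asbool_equiv_eq.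
  - by rewrite /delta posk.
  - by rewrite /delta; congr ((nat_of_bool _)%:R); apply/esym/asbool_equiv_eq/Ac.
have := etrans (dE i) (esym (dE j)); rewrite /delta.
by case: asboolP; case: asboolP => // _ _ /eqP; rewrite oner_eq0.
Qed.

Lemma chord_everywhere j : 2 <= T -> chord_start (pos j).
Proof.
move=> T2; apply: contrapT => j_bad; set p0 := pos j in j_bad.
have T_neq0 : T != 0 by rewrite gt_eqF // (lt_le_trans _ T2) ?ltr0n.
(* The positions [p] from which [i] unit steps lead to [p0] are displaced by the
   number [z] of turns; no unit step undoes this as no chord leaves [p0]. *)
pose rep p i (z : int) := p = p0 - i%:R + z%:~R * T.
(* When [T] is rational a position can have several representations; taking [i] least determines
   [z]. *)
pose min_rep p i z := rep p i z /\ forall i' z', rep p i' z' -> (i <= i')%N.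
have min_rep_unique p i z i' z' : min_rep p i z -> min_rep p i' z' -> z = z'.
  move=> [r m] [r' m']; have ii' : i = i' by have := m _ _ r'; have := m' _ _ r; lia.
  move: r r'; rewrite /rep -ii' => -> /addrI/(mulIf T_neq0)/eqP.
  by rewrite eqr_int => /eqP.
have min_repD p i z : min_rep p i z -> min_rep (p + T) i (z + 1).
  move=> [r m]; split=> [|i' z' r']; first by rewrite /rep r rmorphD; ring.
  apply: (m i' (z' - 1)); rewrite /rep rmorphB; rewrite /rep in r'.
  by rewrite -(addrK T p) r'; ring.
have rep_chord s t i z : chord s t -> rep (pos s) i z ->
    exists i', i = i'.+1 /\ rep (pos t) i' z.
  move=> st r; have [f [_ _ _ tE]] := st; case: i => [|i'] in r *.
    by case: j_bad; exists s, t; split=> //; exists z; rewrite r subr0.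
  by exists i'; split=> //; rewrite /rep tE r -natr1; ring.
have rep_chordV s t i z : chord s t -> rep (pos t) i z -> rep (pos s) i.+1 z.
  move=> [f [_ _ _ tE]] r; rewrite /rep -natr1.
  by apply: (addIr 1); rewrite -tE r; ring.
(* Having a representation is invariant under full turns and chords and holds at [p0], hence
   everywhere. *)
have [all_rep|] := pselect (forall j, exists i z, rep (pos j) i z); last first.
  case=> k; apply: (@chord_invariant (fun p => exists i z, rep p i z) T2 _ _ j).
  - move=> p; split=> -[i [z r]]; exists i.
      by exists (z + 1); rewrite /rep r rmorphD; ring.
    by exists (z - 1); rewrite /rep rmorphB -(addrK T p) r; ring.
  - move=> s t st; split=> -[i [z r]].
      by have [i' [_ r']] := rep_chord _ _ _ _ st r; exists i', z.
    by exists i.+1, z; apply: rep_chordV r.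
  - by exists 0, 0; rewrite /rep subr0 mul0r addr0.
have /choice[delta deltaP] : forall k, exists r : R,
    exists i z, min_rep (pos k) i z /\ r = z%:~R.
  move=> k; have [i [z r]] := all_rep k.
  have ex_i : exists i, `[< exists z, rep (pos k) i z >].
    by exists i; apply/asboolP; exists z.
  case: (ex_minnP ex_i) => i0 /asboolP[z0 r0] min0.
  exists z0%:~R, i0, z0; split=> //; split=> // i' z' r'.
  by apply: min0; apply/asboolP; exists z'.
have deltaE k i z : min_rep (pos k) i z -> delta k = z%:~R.
  by move=> m; have [i' [z' [m' ->]]] := deltaP k;
     rewrite (min_rep_unique _ _ _ _ _ m m').
have deltaD k : delta (k + n)%N = delta k + 1.
  have [i [z [m ->]]] := deltaP k.
  by rewrite (deltaE _ i (z + 1)) ?rmorphD // posD; apply: min_repD.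
(* The displacement grows by 1 per turn and yet would have to be constant. *)
have : delta (0 + n)%N = delta 0%N.
  apply: (@chord_rigid delta 1) => // [k posk|s t st].
    have [i [z [m ->]]] := deltaP k.
    by apply: (deltaE _ i); rewrite posk.
  have [i [z [[r m] ->]]] := deltaP s.
  have [i' [ii' r']] := rep_chord _ _ _ _ st r.
  apply: (deltaE _ i'); split=> // i1 z1 /(rep_chordV _ _ _ _ st)/m.
  by rewrite ii'.
by move/eqP; rewrite deltaD -subr_eq0 addrAC subrr add0r oner_eq0.
Qed.

(** From the position congruent to [i] modulo [T], the chord starting there leads to one congruent
    to [i + 1]. *)
Lemma nat_position (i : nat) : 2 <= T -> exists j : 'I_n, modT i%:R (pos j).
Proof.
move=> T2.
have red k p : modT p (pos k) -> exists j : 'I_n, modT p (pos j).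
  move=> [z pE]; exists (Ordinal (ltn_pmod k (pc_gt0 vP))) => /=.
  exists (z + (k %/ n)%:Z); rewrite pE {1}(divn_eq k n) addnC posM.
  by rewrite rmorphD /= -pmulrn mulrDl; ring.
elim: i => [|i [j [z iE]]]; first by apply: (red 0%N); rewrite pos0; apply: modT_refl.
have [s [t [[f [_ _ _ tE]] [z' sE]]]] := chord_everywhere j T2.
apply: (red t); exists (z - z').
by rewrite -natr1 iE tE sE rmorphB; ring.
Qed.

(** Pigeonhole: two of the integers from 0 to [n] are congruent to the same one of [n] positions
    modulo [T], so their difference is a multiple of [T]. *)
Lemma period_rational : 2 <= T -> exists K w : nat,
  [/\ (0 < w)%N, coprime K w & w%:R * T = K%:R].
Proof.
move=> T2; have T_gt0 : 0 < T by rewrite (lt_le_trans _ T2) ?ltr0n.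
have /choice[c cP] := nat_position^~ T2.
have [i [i' [ii' cE]]] : exists i i' : 'I_n.+1, (i < i')%N /\ c i = c i'.
  have /injectivePn[i [i' iNi' cE]] : ~~ injectiveb (fun i : 'I_n.+1 => c i).
    apply/negP => /injectiveP/leq_card.
    by rewrite !card_ord ltnn.
  case: (ltngtP i i') => [?|?|/val_inj ii']; [by exists i, i'|by exists i', i|].
  by rewrite ii' eqxx in iNi'.
have ci := cP i; rewrite cE in ci.
have [z zE] := modT_trans (cP i') (modT_sym ci).
have zT : z%:~R * T = (i' - i)%:R by rewrite natrB ?(ltnW ii') // zE; ring.
have z_gt0 : 0 < z.
  rewrite -(ltr0z R) -(pmulr_lgt0 _ T_gt0) zT ltr0n subn_gt0 //.
case: z => [z|//] in zT z_gt0 {zE} *; rewrite -pmulrn in zT.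
have {}z_gt0 : (0 < z)%N by [].
set K := (i' - i)%N in zT; set q := gcdn K z.
have q_gt0 : (0 < q)%N by rewrite gcdn_gt0 z_gt0 orbT.
exists (K %/ q)%N, (z %/ q)%N; split.
- by rewrite divn_gt0 // dvdn_leq // dvdn_gcdr.
- by rewrite /coprime -(eqn_pmul2r q_gt0) muln_gcdl !divnK ?dvdn_gcdl ?dvdn_gcdr // mul1n.
- have qR : q%:R != 0 :> R by rewrite pnatr_eq0 -lt0n.
  by apply: (mulIf qR); rewrite mulrAC -!natrM !divnK ?dvdn_gcdl ?dvdn_gcdr.
Qed.

(** In the fractional case [T = K / w] and [m] is [pos] scaled by [w]; unit chords become steps of
    [w] on the integers modulo [K], and one starts at every residue. *)
Lemma extreme_circulant : (forall g, x g \is a Num.int) \/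
  exists (K w : nat) (m : nat -> nat),
  [/\ [/\ (1 < w)%N, (w.*2 < K)%N & coprime K w],
      m 0%N = 0%N, {homo m : i j / (i <= j)%N}, forall j, m (j + n)%N = (m j + K)%N
    & forall q, exists f s t, [/\ negative f, joins f (v s) (v t),
        m s = q %[mod K] & m t = (m s + w)%N]].
Proof.
have [T0|T2] := total_eq0_or_ge2.
  left; apply: integral_of_positive => j; have [i i_lt /eqP ij] := pc_window vP 0 (v j).
  rewrite add0n in i_lt.
  have -> : e j = e i by apply/eqP; rewrite (pc_e vP) eq_sym -(pc_v vP).
  suff -> : x (e i) = 0 by rewrite rpred0.
  apply/eqP; rewrite eq_le extreme_ge0 andbT -T0 -(lerD2l (pos i)) -posS.
  rewrite T0 addr0; have := @pos_mono i.+1 n; rewrite -/T T0 => /(_ i_lt) h.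
  by apply: le_trans h _; rewrite -pos0 pos_mono.
have [K [w [w_gt0 coKw wT]]] := period_rational T2.
have wR_gt0 : 0 < w%:R :> R by rewrite ltr0n.
have wR_neq0 : w%:R != 0 :> R by rewrite gt_eqF.
have /choice[m mP] : forall j, exists m : nat, w%:R * pos j = m%:R.
  move=> j.
  have [a [b E]] : exists a b : int, pos j = a%:~R + b%:~R * T.
    (* The positions lie in the group generated by 1 and [T], which is invariant under chords and
       turns; multiplication by [w] makes them integers. *)
    pose lattice p := exists a b : int, p = a%:~R + b%:~R * T.
    apply: (@chord_invariant lattice T2 _ _ 0%N).
    - move=> p; split=> -[a [b pE]]; exists a.
        by exists (b + 1); rewrite pE rmorphD; ring.
      by exists (b - 1); rewrite rmorphB -(addrK T p) pE; ring.
    - move=> s t [f [_ _ _ ->]]; split=> -[a [b pE]].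
        by exists (a + 1), b; rewrite pE rmorphD; ring.
      by exists (a - 1), b; rewrite rmorphB -(addrK 1 (pos s)) pE; ring.
    - by exists 0, 0; rewrite pos0 mul0r addr0.
  have E' : w%:R * pos j = (w%:Z * a + b * K%:Z)%:~R.
    by rewrite E mulrDr mulrCA wT rmorphD !rmorphM.
  have : 0 <= w%:R * pos j by rewrite mulr_ge0 ?ler0n // -pos0 pos_mono.
  rewrite E' ler0z; case: (_ + _) => // k _.
  by exists k; rewrite -pmulrn.
have m_inj j c : w%:R * pos j = c%:R -> m j = c.
  by rewrite mP => /eqP; rewrite eqr_nat => /eqP.
have m_mono : {homo m : i j / (i <= j)%N}.
  by move=> i j ij; rewrite -(ler_nat R) -!mP ler_pM2l // pos_mono.
have mS j : m (j + n)%N = (m j + K)%N.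
  by apply: m_inj; rewrite posD mulrDr wT mP natrD.
have [w_le1|w_gt1] := leqP w 1.
  left; apply: integral_of_positive => j.
  have w1 : w = 1%N by lia.
  have -> : x (e j) = (m j.+1)%:R - (m j)%:R.
    by rewrite -!mP w1 !mul1r posS addrC addKr.
  by rewrite rpredB ?rpred_nat.
right; exists K, w, m; split=> //.
- split=> //.
  (* [T >= 2] gives [2w <= K]; equality would make [w > 1] a common divisor. *)
  have : (w.*2 <= K)%N.
    by rewrite -(ler_nat R) -wT -muln2 natrM ler_pM2l.
  rewrite leq_eqVlt => /orP[/eqP KE|//].
  by move: coKw; rewrite -KE -muln2 /coprime gcdnC gcdnMr; lia.
- by apply: m_inj; rewrite pos0 mulr0.
move=> q.
(* By coprimality some integer [i] lands, after scaling by [w], on a point congruent to [q] modulo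
   [K]; the required chord starts at the position congruent to [i]. *)
have [i iq] : exists i, (i * w)%N = q %[mod K].
  have /dvdnP[i iE] : (w %| chinese K w q 0)%N.
    by rewrite /dvdn chinese_modr // mod0n.
  by exists i; rewrite -iE chinese_modl.
have [j [z iE]] := nat_position i T2.
have [s [t [[f [fneg fj st tE]] [z' sE]]]] := chord_everywhere j T2.
exists f, s, t; split=> //; last first.
  by apply: m_inj; rewrite tE mulrDr mP mulr1 natrD.
have msE : (m s)%:Z = (i * w)%N%:Z + (z' - z) * K%:Z.
  apply: (@intr_inj R); rewrite rmorphD rmorphM rmorphB /= -!pmulrn -mP natrM.
  by rewrite -wT sE iE; ring.
rewrite -iq; case: (z' - z) msE => k msE.
  by rewrite (_ : m s = (k * K + i * w)%N) ?modnMDl //; lia.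
by rewrite (_ : i * w = (k.+1 * K + m s)%N)%N ?modnMDl //; lia.
Qed.

End ExtremePoint.

(** * Strong minors as vertex partitions *)

Section Minors.
Implicit Types G H C : sgraph.

Lemma val_merge_ends H (h : edge H) (hNloop : ~~ is_loop h) z :
  val (merge_ends hNloop z) = if z != (ends h).2 then z else (ends h).1.
Proof. by rewrite val_insubd. Qed.

Lemma merge_ends_eq H (h : edge H) (hNloop : ~~ is_loop h) :
  merge_ends hNloop (ends h).1 = merge_ends hNloop (ends h).2.
Proof. by apply: val_inj; rewrite !val_merge_ends eqxx /=; case: ifP. Qed.

Lemma merge_ends_val H (h : edge H) (hNloop : ~~ is_loop h) z :
  merge_ends hNloop (val z) = z.
Proof. exact: valKd. Qed.

(* Stated with colourings [phi] rather than paths, the connectedness of the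
   classes of [pi] passes to contractions by composing [phi] with the merging
   map. *)
Definition positively_connected H (T : Type) (pi : vertex H -> T) : Prop :=
  forall phi : vertex H -> bool,
    (forall f : edge H, ~~ negative f -> pi (ends f).1 = pi (ends f).2 ->
       phi (ends f).1 = phi (ends f).2) ->
  forall a b, pi a = pi b -> phi a = phi b.

(** Induction on the number of edges of [H]: an edge outside the image of [g] is deleted or, if it
    is positive inside a class and has no parallel edge, contracted. Once [g] is onto, [H] itself is
    isomorphic to [C]. *)
Lemma strong_minor_of_partition G H C (pi : vertex H -> vertex C)
    (g : edge C -> edge H) :
  strong_minor G H -> (forall c : edge C, ~~ is_loop c) ->
  injective g -> (forall c, negative (g c) = negative c) ->
  (forall c, joins c (pi (ends (g c)).1) (pi (ends (g c)).2)) ->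
  (forall u, exists w, pi w = u) ->
  positively_connected pi -> has_strong_minor G C.
Proof.
move=> GH CNloop.
have [m] := ubnP #|edge H|; elim: m H GH pi g => // m IH H GH pi g Hm.
move=> g_inj g_neg g_ends pi_surj pi_conn.
have codomN c : pi (ends (g c)).1 != pi (ends (g c)).2.
  apply/eqP => pi_eq; have := CNloop c; rewrite /is_loop.
  by have := g_ends c; rewrite pi_eq => /joins_endsP[[-> ->]|[-> ->]]; rewrite eqxx.
have gN h : h \notin codom g -> forall c, g c != h.
  by move=> hg c; apply: contraNneq hg => <-; apply: codom_f.
have cardh h : #|{: {f : edge H | f != h}}| < m.
  have : 0 < #|edge H| by apply/card_gt0P; exists h.
  by rewrite card_sig (cardC1 h); lia.
have delete h : h \notin codom g ->
    positively_connected (H := delete_edge h) pi -> has_strong_minor G C.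
  move=> hg conn.
  pose g' c : edge (delete_edge h) := exist (fun f => f != h) (g c) (gN h hg c).
  apply: (IH _ (strong_minor_delete h GH) pi g') => //; first exact: cardh.
  by move=> c c' [/g_inj].
have delete_bad h : h \notin codom g ->
    [|| negative h, pi (ends h).1 != pi (ends h).2 | is_loop h] ->
    has_strong_minor G C.
  move=> hg bad; apply: (delete h hg) => phi phiP; apply: pi_conn => f fpos pif.
  have [fh|fNh] := eqVneq f h; last by apply: (phiP (exist _ f fNh)).
  by move: bad; rewrite -fh (negPf fpos) pif eqxx => /= /eqP->.
have [h hg|all_g] := pickP (fun h => h \notin codom g); last first.
  (* Every edge now joins different classes, so the colouring [z == a] is admissible and
     connectedness leaves one vertex per class. *)
  have pi_inj : injective pi.
    move=> a b ab; apply/eqP; rewrite eq_sym.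
    rewrite -(pi_conn (fun z => z == a) _ a b ab) ?eqxx // => f _ pif.
    have /codomP[c fc] : f \in codom g by have := all_g f; case: (f \in _).
    by have := codomN c; rewrite -fc pif eqxx.
  have g_bij : bijective g.
    by apply: inj_card_bij => //; rewrite -(card_codom g_inj); apply: subset_leq_card;
       apply/fintype.subsetP => f _; have := all_g f; case: (f \in _).
  have [g' gK g'K] := g_bij.
  exists H => //; exists pi, g'; split.
  - have [w wK] := choice pi_surj.
    by exists w => // x; apply: pi_inj.
  - by exists g.
  - move=> f x y; rewrite -{2}[f]g'K; move: (g' f) => c.
    have := g_ends c; rewrite /joins; case: (ends (g c)) => a b /=.
    case: (ends c) => p q; rewrite !xpair_eqE => /orP[]/andP[/eqP-> /eqP->].
      by rewrite !(inj_eq pi_inj).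
    rewrite !(inj_eq pi_inj) orbC; congr (_ || _); exact: andbC.
  - by move=> f; rewrite -g_neg g'K.
have [/delete_bad-/(_ hg)//|] :=
  boolP [|| negative h, pi (ends h).1 != pi (ends h).2 | is_loop h].
rewrite !negb_or negbK => /and3P[hpos /eqP pih hNloop].
(* Contracting [h] would turn a parallel edge into a loop. A negative parallel edge is deleted
   first; a positive one connects as well as [h], which is then deleted instead. *)
have [f /andP[fNh fh]|no_parallel] :=
    pickP (fun f => (f != h) && joins f (ends h).1 (ends h).2).
  have pif : pi (ends f).1 = pi (ends f).2.
    by case/joins_endsP: fh => -[-> ->].
  have fg : f \notin codom g.
    by apply/codomP => -[c fc]; have := codomN c; rewrite -fc pif eqxx.
  have [fneg|fpos] := boolP (negative f).
    by apply: (delete_bad f fg); rewrite fneg.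
  apply: (delete h hg) => phi phiP; apply: pi_conn => f' f'pos pif'.
  have [f'h|f'Nh] := eqVneq f' h; last by apply: (phiP (exist _ f' f'Nh)).
  have := phiP (exist _ f fNh) fpos pif; rewrite /= f'h.
  by case/joins_endsP: fh => -[-> ->].
have merge_pi z : pi (val (merge_ends hNloop z)) = pi z.
  by rewrite val_merge_ends; case: eqVneq => [->|].
pose g' c : edge (contract_edge hNloop) :=
  exist (fun f => f != h) (g c) (gN h hg c).
apply: (IH (contract_edge hNloop) _ (fun z => pi (val z)) g') => //.
- apply: strong_minor_contract => // f; rewrite /is_loop /= -val_eqE /=.
  rewrite !val_merge_ends; have := no_parallel (val f); rewrite (valP f) /=.
  rewrite /joins; case: (ends (val f)) => p q; rewrite !xpair_eqE /=.
  case: (ends h) => a b /=.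
  by case: (eqVneq p b) => [->|_]; case: (eqVneq q b) => [->|_];
     rewrite ?eqxx ?andbT ?andbF ?orbF //= eq_sym => ->.
- exact: cardh.
- by move=> c c' [/g_inj].
- by move=> c; rewrite !merge_pi.
- move=> u; have [w <-] := pi_surj u.
  by exists (merge_ends hNloop w); rewrite merge_pi.
move=> phi phiP a b ab.
have := pi_conn (fun z => phi (merge_ends hNloop z)) _ (val a) (val b) ab.
rewrite !merge_ends_val; apply=> f fpos pif.
have [->|fNh] := eqVneq f h.
  by rewrite merge_ends_eq.
by apply: (phiP (exist _ f fNh)) => //=; rewrite !merge_pi.
Qed.

(** The set [A] stands for the positive edges of the deletion or of the contraction, which share
    this edge type. *)
Lemma card_pos_edges_remove H (h : edge H) (A : {set {f : edge H | f != h}}) :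
  (forall f, (f \in A) = ~~ negative (val f)) ->
  #|A| + ~~ negative h = #|pos_edges H|.
Proof.
move=> AE; rewrite [in RHS](cardsD1 h) inE addnC; congr (_ + _).
rewrite -(card_imset (mem A) val_inj); apply: eq_card => f.
rewrite !inE; apply/imsetP/andP => [[f' Af' ->]|[fNh fpos]].
  by rewrite (valP f') -AE.
by exists (exist _ f fNh) => //; rewrite AE.
Qed.

Lemma notin_codom_val (E E' : finType) (h : E) (g : E -> E') f :
  f \notin codom (fun f : {f : E | f != h} => g (val f)) ->
  f \notin codom g \/ f = g h.
Proof.
move=> fN; have [/codomP[f' fE]|] := boolP (f \in codom g); last by left.
right; rewrite fE; congr g; apply: contraNeq fN => f'Nh.
by apply/codomP; exists (exist _ f' f'Nh).
Qed.

(** A contraction removes one vertex and one positive edge, while deleting a positive edge leaves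
    fewer positive edges than vertices for good. Equality at the end thus means that every lost
    positive edge was contracted. *)
Lemma strong_minor_partition G H : strong_minor G H ->
  #|pos_edges G| <= #|vertex G| ->
  exists (pi : vertex G -> vertex H) (g : edge H -> edge G),
  [/\ injective g, forall f, negative (g f) = negative f,
      forall f, ends f = (pi (ends (g f)).1, pi (ends (g f)).2),
      #|pos_edges H| <= #|vertex H|
    & #|pos_edges H| = #|vertex H| ->
      forall f, ~~ negative f -> f \notin codom g -> pi (ends f).1 = pi (ends f).2].
Proof.
elim=> [|{}H h _ IH|{}H h hNloop _ IH hpos _] Gle.
- exists id, id; split=> // [f|_ f _]; first exact: surjective_pairing.
  by rewrite codom_f.
- have [pi [g [g_inj g_neg g_ends le eq_le]]] := IH Gle.
  have card : #|pos_edges (delete_edge h)| + ~~ negative h = #|pos_edges H|.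
    by apply: card_pos_edges_remove => f; rewrite inE.
  exists pi, (fun f => g (val f)); split=> //.
  - by move=> f f' /g_inj/val_inj.
  - by move=> f; apply: g_ends.
  - by apply: leq_trans le; rewrite -card leq_addr.
  - move=> Heq; rewrite {}Heq [X in X + _]/= in card.
    have [hneg fV] : negative h /\ #|pos_edges H| = #|vertex H|.
      by case: (negative h) card le => /=; lia.
    move=> f fpos /notin_codom_val[fg|fE]; first exact: eq_le.
    by rewrite fE g_neg hneg in fpos.
- have [pi [g [g_inj g_neg g_ends le eq_le]]] := IH Gle.
  have cardE : #|pos_edges (contract_edge hNloop)| + ~~ negative h = #|pos_edges H|.
    by apply: card_pos_edges_remove => f; rewrite inE.
  rewrite hpos in cardE.
  have cardV : #|vertex (contract_edge hNloop)| + 1 = #|vertex H|.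
    have : 0 < #|vertex H| by apply/card_gt0P; exists (ends h).2.
    by rewrite card_sig (cardC1 (ends h).2); lia.
  exists (fun z => merge_ends hNloop (pi z)), (fun f => g (val f)); split=> //.
  - by move=> f f' /g_inj/val_inj.
  - by move=> f /=; have := g_ends (val f); case: (ends (val f)) => p q [-> ->].
  - by lia.
  - move=> Heq f fpos /notin_codom_val[fg|->].
      by congr merge_ends; apply: eq_le => //; lia.
    have /= <- := congr1 fst (g_ends h); have /= <- := congr1 snd (g_ends h).
    exact: merge_ends_eq.
Qed.

End Minors.

(** * Cutting the circle into blocks *)

Lemma odd_block_count K w : 1 < w -> w.*2 < K -> coprime K w ->
  exists k, [/\ odd k, 5 <= k, K <= k * w.-1 & k * w.+1 <= 3 * K].
Proof.
move=> w1 wK coKw; case: (ltngtP w 2) => [|w_gt2|w2]; first by lia.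
  have [K_le|K_gt] := leqP K (5 * w.-1); first by exists 5; split=> //; lia.
  (* [c] is the ceiling of [K / w.-1] *)
  set c := (K + w.-2) %/ w.-1.
  have cE := divn_eq (K + w.-2) w.-1; rewrite -/c in cE.
  have w'0 : 0 < w.-1 by lia.
  have := ltn_pmod (K + w.-2) w'0; move: cE.
  move: (_ %% w.-1) c => r c cE r_lt.
  (* The upper bound leaves room to pass from the ceiling to the next odd number. *)
  exists (if odd c then c else c.+1).
  case: ifP => c_odd; split=> //; first [by rewrite /= c_odd | nia].
(* For [w = 2] coprimality makes [K] itself odd, and each block is a single point. *)
exists K; rewrite w2; split; [|lia|lia|lia].
by move: coKw; rewrite w2 coprimen2.
Qed.

Lemma divn_window a i K : i * K <= a < i.+1 * K -> a %/ K = i.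
Proof.
rewrite mulSn => /andP[ia ai]; rewrite -(subnKC ia) divnMDl; last by lia.
by rewrite divn_small ?addn0 //; lia.
Qed.

(** [q * k %/ K] is the block of the point [q] when a circle of [K] points is cut into [k]
    blocks. *)
Lemma block_point K k w i : 0 < k -> K <= k * w.-1 -> k * w.+1 <= 3 * K ->
  1 < w ->
  exists q, q * k %/ K = i /\ (q + w) * k %/ K = i.+2.
Proof.
move=> k0 Kk kK w1.
have kK' : k <= K by nia.
have Kk1 : K + k <= w * k by case: w w1 Kk {kK} => [|w'] //=; nia.
have kK1 : w * k + k <= 3 * K by nia.
(* [b] collects the two lower bounds on [q * k]; the least such [q], the ceiling of [b / k], also
   meets the upper bounds. Truncated subtraction is harmless under the maximum. *)
set b := maxn (i * K) (i.+2 * K - w * k).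
have bE := divn_eq (b + k.-1) k; have r_lt := ltn_pmod (b + k.-1) k0.
exists ((b + k.-1) %/ k); move: (_ %/ k) (_ %% k) bE r_lt => q r.
by rewrite /b !mulSn => bE r_lt; split; apply: divn_window;
  rewrite ?mulnDl !mulSn; lia.
Qed.

Lemma modn_scale K k a b : 0 < K -> a = b %[mod K] ->
  a * k %/ K = b * k %/ K %[mod k].
Proof.
move=> K0 ab; rewrite (divn_eq a K) (divn_eq b K) ab.
have scale q r : (q * K + r) * k %/ K = q * k + r * k %/ K.
  by rewrite mulnDl mulnAC divnMDl.
by rewrite !scale !modnMDl.
Qed.

Lemma iter_ordS k (i : 'I_k) r : iter r (@ordS k) i = (i + r) %% k :> nat.
Proof.
elim: r => [|r IH]; first by rewrite addn0 modn_small.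
by rewrite iterS [LHS]/= IH -addn1 modnDml addn1 addnS.
Qed.

Lemma iter_ordS_neq k (i : 'I_k) r : 0 < r < k -> iter r (@ordS k) i != i.
Proof.
move=> /andP[r0 rk]; rewrite -(inj_eq (@ord_inj _)) iter_ordS.
rewrite -[X in _ != X](modn_small (ltn_ord i)) -[X in _ != X %[mod _]]addn0.
by rewrite eqn_modDl mod0n modn_small // -lt0n.
Qed.

Lemma flow_circuit_Nloop k (c : edge (flow_circuit k)) : 2 < k -> ~~ is_loop c.
Proof.
move=> k2; rewrite /is_loop eq_sym; case: c => i /=.
  by apply: (@iter_ordS_neq k i 1); lia.
by apply: (@iter_ordS_neq k i 2); lia.
Qed.

(** * The flow-circuit obtained by contracting blocks *)

Section Blocks.
Variables (G : sgraph) (n : nat) (v : nat -> vertex G) (e : nat -> edge G).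
Hypothesis vP : pos_cycle n v e.
Variables (k : nat) (beta : nat -> nat).
Hypothesis k5 : 5 <= k.
Hypothesis beta0 : beta 0 = 0.
Hypothesis betaD : forall j, beta (j + n) = beta j + k.
Hypothesis beta_mono : {homo beta : i j / i <= j}.
Hypothesis beta_chord : forall i : 'I_k, exists f s t,
  [/\ negative f, joins f (v s) (v t), beta s = i %[mod k]
    & beta t = i + 2 %[mod k]].

Let k0 : 0 < k. Proof. exact: leq_trans k5. Qed.

Lemma beta_n : beta n = k.
Proof. by rewrite -[n]add0n betaD beta0. Qed.

Lemma beta_mod i j : i = j %[mod n] -> beta i = beta j %[mod k].
Proof.
have betaM a q : beta (a + q * n) = beta a + q * k.
  by elim: q => [|q IH]; rewrite ?addn0 // mulSn addnCA addnC betaD IH mulSn; lia.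
move=> ij; rewrite (divn_eq i n) (divn_eq j n) ij !(addnC (_ * n)) !betaM.
by rewrite !(addnC _ (_ * k)) !modnMDl.
Qed.

(** Each block contains the start of its own chord. *)
Lemma beta_onto c : c < k -> exists2 j, j < n & beta j = c.
Proof.
move=> c_lt; have [f [s [t [_ _ sc _]]]] := beta_chord (Ordinal c_lt).
have n0 := pc_gt0 vP; have s_lt := ltn_pmod s n0.
have := beta_mod (modn_mod s n); rewrite sc /= [RHS]modn_small // => sE.
have := beta_mono (ltnW s_lt); rewrite beta_n leq_eqVlt => /orP[/eqP sk|s_lt_k].
  (* The value [k] is block 0 again, represented at index 0. *)
  by exists 0; rewrite // beta0; rewrite sk modnn in sE.
by exists (s %% n) => //; rewrite -sE [RHS]modn_small.
Qed.

(** The last index below [n] with [beta j <= c] works: no block is empty, so [beta] skips no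
    value. *)
Lemma beta_crossing c : c < k -> exists j, [/\ j < n, beta j = c & beta j.+1 = c.+1].
Proof.
move=> c_lt; have n0 := pc_gt0 vP.
have exP : exists j, (j < n) && (beta j <= c) by exists 0; rewrite n0 beta0.
have leP j : (j < n) && (beta j <= c) -> j <= n by lia.
case: (ex_maxnP exP leP) => j /andP[j_lt jc] j_max.
have [s s_lt sc] := beta_onto c_lt.
have sj : s <= j by apply: j_max; rewrite s_lt sc /=.
have jE : beta j = c by have := beta_mono sj; lia.
have gt_c : c < beta j.+1.
  have [jn|jn] := ltnP j.+1 n.
    by have := j_max j.+1; rewrite jn ltnn leqNgt; case: (c < _) => // /(_ isT).
  by rewrite (_ : j.+1 = n) ?beta_n //; lia.
exists j; split=> //; apply/eqP; rewrite eqn_leq gt_c andbT.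
have [c1|c1] := ltnP c.+1 k.
  have [s1 _ s1E] := beta_onto c1; rewrite -s1E; apply: beta_mono.
  by rewrite ltnNge; apply/negP => /beta_mono; rewrite s1E jE ltnn.
by have := beta_mono j_lt; rewrite beta_n; lia.
Qed.

Lemma flow_circuit_minor : has_strong_minor G (flow_circuit k).
Proof.
have /choice[idx idxP] : forall u, exists j, v j = u.
  by move=> u; have [j _ <-] := pc_v_surj vP u; exists j.
pose pi u : 'I_k := Ordinal (ltn_pmod (beta (idx u)) k0).
have piE j : pi (v j) = beta j %% k :> nat.
  by apply: beta_mod; apply/eqP; rewrite -(pc_v vP) idxP.
have /choice[a aP] := fun i : 'I_k => beta_crossing (ltn_ord i).
have /choice[F FP] : forall i : 'I_k, exists f, negative f /\
    exists s t, [/\ joins f (v s) (v t), pi (v s) = i & pi (v t) = ordS (ordS i)].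
  move=> i; have [f [s [t [fneg fj si ti]]]] := beta_chord i.
  exists f; split=> //; exists s, t; split=> //; apply: ord_inj; rewrite piE.
    by rewrite si modn_small.
  by rewrite (iter_ordS i 2).
have aF i j : e (a i) != F j.
  by apply: contraTneq (FP j).1 => <-; apply: (pc_e_pos vP).
pose g (c : edge (flow_circuit k)) :=
  match c with inl i => e (a i) | inr i => F i end.
apply: (@strong_minor_of_partition G G (flow_circuit k) pi g).
- exact: strong_minor_refl.
- by move=> c; apply: flow_circuit_Nloop; lia.
- move=> [i|i] [j|j] /= gij.
  + congr inl; apply: ord_inj; have [i_lt <- _] := aP i; have [j_lt <- _] := aP j.
    move/eqP: gij; rewrite (pc_e vP) => /eqP; rewrite !modn_small // => -> //.
  + by have := aF i j; rewrite gij eqxx.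
  + by have := aF j i; rewrite gij eqxx.
  + congr inr; have [_ [s [t [fj si ti]]]] := FP i; have [_ [s' [t' []]]] := FP j.
    rewrite -gij => fj' sj tj.
    have [[vs _]|[vs vt]] := joins_pair fj fj'; first by rewrite -si -sj vs.
    (* If one edge served both [i] and [j], in opposite directions, then [i + 4] would equal [i]
       modulo [k], impossible for [k >= 5]. *)
    have := @iter_ordS_neq k i 4 k5.
    by rewrite /= -ti vt sj -tj -vs si eqxx.
- by move=> [i|i] /=; [apply/negbTE/(pc_e_pos vP) | case: (FP i)].
- have ends_pi f x y c : joins f x y -> @joins (flow_circuit k) c (pi x) (pi y) ->
      @joins (flow_circuit k) c (pi (ends f).1) (pi (ends f).2).
    by move=> /joins_endsP[[-> ->]|[-> ->]] //; rewrite joinsC.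
  move=> [i|i] /=.
    apply: ends_pi (pc_joins vP (a i)) _; have [_ ai aSi] := aP i.
    have -> : pi (v (a i)) = i by apply: ord_inj; rewrite piE ai modn_small.
    have -> : pi (v (a i).+1) = ordS i by apply: ord_inj; rewrite piE aSi.
    by rewrite /joins /= eqxx.
  have [_ [s [t [fj si ti]]]] := FP i.
  by apply: ends_pi fj _; rewrite si ti /joins /= eqxx.
- move=> i; have [j _ jE] := beta_onto (ltn_ord i).
  by exists (v j); apply: ord_inj; rewrite piE jE modn_small.
move=> phi phiP u u' uu'.
have step j : beta j.+1 = beta j -> phi (v j.+1) = phi (v j).
  move=> jE; have := phiP (e j) (pc_e_pos vP j).
  have : pi (v j) = pi (v j.+1) by apply: ord_inj; rewrite !piE jE.
  by have /joins_endsP[[-> ->]|[-> ->]] := pc_joins vP j => piE1 -> //.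
have block s t : s <= t -> beta s = beta t -> phi (v s) = phi (v t).
  move=> st; rewrite -(subnKC st); elim: (t - s) => [|d IH]; first by rewrite addn0.
  rewrite addnS => sd; have b1 := beta_mono (leq_addr d s).
  have b2 := beta_mono (leqnSn (s + d)).
  by rewrite step ?IH //; lia.
have [s s_lt su] := pc_v_surj vP u; have [t t_lt tu] := pc_v_surj vP u'.
rewrite -su -tu in uu' *.
wlog st : s t {u u' su tu} s_lt t_lt uu' / s <= t => [hw|].
  by case/orP: (leq_total s t) => st; [apply: hw | symmetry; apply: hw].
have {}uu' : beta s = beta t %[mod k] by rewrite -!piE uu'.
have bst := beta_mono st; have := beta_mono (ltnW t_lt); rewrite beta_n.
rewrite leq_eqVlt => /orP[/eqP tk|tk]; last first.
  by apply: block => //; move: uu'; rewrite !modn_small //; lia.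
have [sk|sk] := ltnP (beta s) k; last by apply: block => //; lia.
move: uu'; rewrite tk modnn modn_small // => s0.
(* Block 0 may have a second piece at the end of the window, where [beta] is [k]; the two pieces
   meet at [v n = v 0]. *)
rewrite -(@block 0 s) ?beta0 // (@block t n) ?beta_n //; last exact: ltnW.
by have := pc_vD vP 0; rewrite add0n => ->.
Qed.

End Blocks.

(** * The half-integral extreme point *)

(** The two arcs between the distinct ends of [f] share no edge and together cover the circuit. *)
Lemma complementary_flows (G : sgraph) (n : nat) (v : nat -> vertex G)
    (e : nat -> edge G) (f : edge G) :
  pos_cycle n v e -> negative f -> ~~ is_loop f ->
  exists C1 C2, [/\ flow C1, flow C2, f \in C1, f \in C2
    & forall h, ~~ negative h -> (h \in C1) (+) (h \in C2)].
Proof.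
move=> vP fneg fNloop; have n0 := pc_gt0 vP.
have [s s_lt vs] := pc_v_surj vP (ends f).1.
have [t st vt] := pc_window vP s (ends f).2.
have sNt : s != t.
  by apply: contraNneq fNloop => stE; rewrite /is_loop -vs -vt stE.
have fj : joins f (v s) (v (s + (t - s))).
  by rewrite subnKC ?vs ?vt ?joins_ends //; lia.
have fj' : joins f (v t) (v (t + (s + n - t))).
  by rewrite subnKC ?(pc_vD vP) ?vs ?vt 1?joinsC ?joins_ends //; lia.
exists (f |: [set e (s + i) | i : 'I_(t - s)]),
       (f |: [set e (t + i) | i : 'I_(s + n - t)]).
split; rewrite ?inE ?eqxx //; try by apply: (arc_flow vP) => //; lia.
move=> h hpos; have hNf : h != f by apply: contraNneq hpos => ->.
rewrite !inE (negPf hNf) /=; have [j js <-] := pc_e_window vP s hpos.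
have -> : (e j \in [set e (s + i) | i : 'I_(t - s)]) = (j < t).
  apply/imsetP/idP => [[i _ /eqP]|jt].
    rewrite (pc_e vP) => /eqP ji; have i_lt := ltn_ord i.
    have -> : j = s + i by apply: (eq_mod_window (a := s) (n := n)) ji; lia.
    by lia.
  have jst : j - s < t - s by lia.
  by exists (Ordinal jst) => //=; rewrite subnKC //; lia.
have -> : (e j \in [set e (t + i) | i : 'I_(s + n - t)]) = (t <= j).
  apply/imsetP/idP => [[i _ /eqP]|jt].
    rewrite (pc_e vP) => /eqP ji; have i_lt := ltn_ord i.
    have -> : j = t + i by apply: (eq_mod_window (a := s) (n := n)) ji; lia.
    by lia.
  have jst : j - t < s + n - t by lia.
  by exists (Ordinal jst) => //=; rewrite subnKC //; lia.
by case: ltnP.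
Qed.

Lemma flow_negative_unique (G : sgraph) (C : {set edge G}) f h :
  flow C -> f \in C -> h \in C -> negative f -> negative h -> f = h.
Proof.
move=> [_ /eqP/cards1P[a aE]] fC hC fneg hneg.
have : f \in C :&: neg_edges G by rewrite !inE fC.
have : h \in C :&: neg_edges G by rewrite !inE hC.
by rewrite aE !inE => /eqP -> /eqP ->.
Qed.

Section HalfPoint.
Variables (R : realType) (G : sgraph) (k : nat).
Variables (pi : vertex G -> 'I_k) (g : edge (flow_circuit k) -> edge G).
Hypotheses (k5 : 5 <= k) (k_odd : odd k).
Hypothesis g_inj : injective g.
Hypothesis g_neg : forall c, negative (g c) = negative c.
Hypothesis g_ends :
  forall c, joins c (pi (ends (g c)).1) (pi (ends (g c)).2).
Hypothesis pi_const : forall f, ~~ negative f -> f \notin codom g ->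
  pi (ends f).1 = pi (ends f).2.

Local Notation S i := (g (inl i)).
Local Notation N i := (g (inr i)).

Lemma crosses_g c' d :
  crosses (fun u => pi u == c') (g d) = (@crosses (flow_circuit k) (pred1 c') d).
Proof. by rewrite [RHS](crosses_joins _ (g_ends d)). Qed.

(** Positive edges outside the image of [g] stay inside a class, so only edges [S i] can cross the
    cut around a class. *)
Lemma positive_crossing f c' : ~~ negative f ->
  crosses (fun u => pi u == c') f ->
  exists2 i, f = S i & (i == c') (+) (ordS i == c').
Proof.
move=> fpos; have [/codomP[[i|i] fE]|fN] := boolP (f \in codom g).
- by rewrite fE crosses_g; exists i.
- by rewrite fE g_neg in fpos.
- by rewrite /crosses (pi_const fpos fN) addbb.
Qed.

(** The class [ordS i] contains no end of [N c], so in the flow only the two edges [S] at this class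
    can cross its cut; by parity both or neither do. *)
Lemma flow_step C c i : flow C -> N c \in C ->
  ordS i != c -> ordS i != ordS (ordS c) -> (S i \in C) = (S (ordS i) \in C).
Proof.
move=> Cflow cC ic iSc.
have iSi (j : 'I_k) : ordS j != j by apply: (@iter_ordS_neq k j 1); lia.
have other f : f \in C -> crosses (fun u => pi u == ordS i) f ->
    exists j, [/\ S j \in C, S j != f & (j == ordS i) || (j == i)].
  move=> fC cr; have [f' f'C [f'f cr']] := circuit_crosses_twice Cflow.1 fC cr.
  have [f'neg|f'pos] := boolP (negative f').
    have f'E : f' = N c.
      by apply: flow_negative_unique Cflow f'C cC f'neg _; rewrite g_neg.
    move: cr'; rewrite f'E crosses_g /crosses /= eq_sym (negPf ic).
    by rewrite eq_sym (negPf iSc).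
  have [j f'E jcr] := positive_crossing f'pos cr'.
  exists j; rewrite -f'E; split=> //.
  by move: jcr; rewrite (inj_eq (@ordS_inj k)); case: (j == _).
apply/idP/idP => iC.
  have [|j [jC ji /orP[/eqP jE|/eqP jE]]] := other _ iC.
  - by rewrite crosses_g /crosses /= eqxx eq_sym (negPf (iSi i)).
  - by rewrite -jE.
  - by rewrite jE eqxx in ji.
have [|j [jC ji /orP[/eqP jE|/eqP jE]]] := other _ iC.
- by rewrite crosses_g /crosses /= eqxx (negPf (iSi _)).
- by rewrite jE eqxx in ji.
- by rewrite -jE.
Qed.

(** [N c] crosses the cuts around the classes [c] and [c + 2], so a further edge [S] crosses each;
    as [k >= 5], these classes are not neighbours and the two edges differ. *)
Lemma flow_two_edges C c : flow C -> N c \in C ->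
  exists i j, [/\ i != j, S i \in C & S j \in C].
Proof.
move=> Cflow cC; have neg f : f \in C -> f != N c -> ~~ negative f.
  move=> fC; apply: contraNN => fneg; apply/eqP.
  by apply: flow_negative_unique Cflow fC cC fneg _; rewrite g_neg.
have neq r (j : 'I_k) : 0 < r < k -> (iter r (@ordS k) j == j) = false.
  by move=> /iter_ordS_neq/negbTE.
have cr c' : (c == c') (+) (ordS (ordS c) == c') ->
    exists2 i, S i \in C & (i == c') || (ordS i == c').
  move=> crc; have [|f fC [fc fcr]] :=
    circuit_crosses_twice (phi := fun u => pi u == c') Cflow.1 cC.
    by rewrite crosses_g.
  have [i fE ic] := positive_crossing (neg f fC fc) fcr.
  by exists i; [rewrite -fE | case: (i == c') ic].
have neq2 := neq 2 c; rewrite /= in neq2.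
have [|i iC ic] := cr c; first by rewrite eqxx neq2 //; lia.
have [|j jC jc] := cr (ordS (ordS c)).
  by rewrite eqxx eq_sym neq2 //; lia.
exists i, j; split=> //; apply/eqP => ij; move: jc ic; rewrite -ij.
have S_inj := inj_eq (@ordS_inj k); rewrite S_inj.
move=> /orP[]/eqP-> /orP[].
- by rewrite neq2 //; lia.
- by rewrite (neq 3 c) //; lia.
- by rewrite (neq 1 c) //; lia.
- by rewrite neq2 //; lia.
Qed.

(** These flows will force the coordinates of [S c] and [S (ordS c)] to sum to 1. *)
Lemma tight_flow_exists n (v : nat -> vertex G) (e : nat -> edge G) c : pos_cycle n v e ->
  exists C, [/\ flow C, N c \in C
    & forall i, (S i \in C) = (i == c) || (i == ordS c)].
Proof.
move=> vP.
have cneg : negative (N c) by rewrite g_neg.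
have cNloop : ~~ is_loop (N c).
  rewrite /is_loop; apply/eqP => endsE.
  have := @flow_circuit_Nloop k (inr c) (ltn_trans (isT : 2 < 4) k5).
  rewrite /is_loop; have := g_ends (inr c); rewrite endsE.
  by move=> /joins_endsP[[-> ->]|[-> ->]]; rewrite eqxx.
have iterE (i : 'I_k) : exists2 r, r < k & i = iter r (@ordS k) c.
  exists ((i + (k - c)) %% k); first by rewrite ltn_pmod //; lia.
  apply: ord_inj; rewrite iter_ordS modnDmr addnCA subnKC ?(ltnW (ltn_ord c)) //.
  by rewrite modnDr modn_small.
(* Parity passes across every class [c + r + 1] except the ends of [N c], of which [c + 2] is the
   case [r = 1]. *)
have stepr C r : flow C -> N c \in C -> r.+1 < k -> r != 1 ->
    (S (iter r (@ordS k) c) \in C) = (S (iter r.+1 (@ordS k) c) \in C).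
  move=> Cflow cC rk r1; apply: (flow_step Cflow cC).
    by apply: (@iter_ordS_neq k c r.+1); lia.
  rewrite (inj_eq (@ordS_inj k)); case: r => [|[|r]] // in rk r1 *.
    by rewrite eq_sym; apply: (@iter_ordS_neq k c 1); lia.
  by rewrite iterS (inj_eq (@ordS_inj k)) (@iter_ordS_neq k c r.+1) //; lia.
have tail C r : flow C -> N c \in C -> 2 <= r < k ->
    (S (iter r (@ordS k) c) \in C) = (S (ordS (ordS c)) \in C).
  move=> Cflow cC; elim: r => // r IH rk.
  have [->|r1] := eqVneq r 1; first by [].
  by rewrite -stepr ?IH //; lia.
have main C C' : flow C -> flow C' -> N c \in C -> N c \in C' ->
    (forall h, ~~ negative h -> (h \in C) (+) (h \in C')) -> S c \in C ->
    forall i, (S i \in C) = (i == c) || (i == ordS c).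
  move=> Cflow C'flow cC cC' compl c0C.
  have SC' i : (S i \in C') = (S i \notin C).
    by have := compl (S i); rewrite g_neg => /(_ isT); case: (_ \in _); case: (_ \in _).
  have c1C : S (ordS c) \in C by rewrite -(stepr C 0) //; lia.
  have c2C : S (ordS (ordS c)) \notin C.
    apply/negP => c2C; have [i [_ [_ iC' _]]] := flow_two_edges C'flow cC'.
    move: iC'; rewrite SC' => /negP; apply.
    have [[|[|r]] rk ->] := iterE i => //.
    by rewrite tail //; lia.
  move=> i; have [[|[|r]] rk ->] := iterE i.
  - by rewrite /= eqxx.
  - by rewrite /= eqxx orbT.
    rewrite tail // (negPf c2C).
    rewrite (negPf (@iter_ordS_neq k c r.+2 rk)).
    by rewrite iterS (inj_eq (@ordS_inj k)) (negPf (@iter_ordS_neq k c r.+1 _)) //; lia.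
(* Of the two flows through [N c], the one with [S c] will do: it also has the
   next edge, and its other edges [S i] are all in or all out; they are out as
   the complementary flow needs two of them. *)
have [C1 [C2 [C1f C2f cC1 cC2 compl]]] := complementary_flows vP cneg cNloop.
have [cC|cC] := boolP (S c \in C1); first by exists C1; split=> //; apply: (main C1 C2).
exists C2; split=> //; apply: (main C2 C1) => //.
  by move=> h /compl; rewrite addbC.
by have := compl (S c); rewrite g_neg (negPf cC) => /(_ isT).
Qed.

Local Open Scope ring_scope.

Definition half_weight (f : edge G) : R :=
  if f \in codom (fun i : 'I_k => S i) then 2^-1 else 0.

(** The largest deficit of a flow through [f], hence the least nonnegative weight on [f] that covers
    all of them. *)
Definition missing_weight (f : edge G) : R :=
  \big[Num.max/0]_(C : {set edge G} | `[< flow C >] && (f \in C))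
    (1 - \sum_(h in C | ~~ negative h) half_weight h).

Definition half_point : {ffun edge G -> R} :=
  [ffun f => if negative f then missing_weight f else half_weight f].

Lemma sum_flow (d : edge G -> R) C f : flow C -> f \in C -> negative f ->
  \sum_(h in C) d h = d f + \sum_(h in C | ~~ negative h) d h.
Proof.
move=> Cflow fC fneg; rewrite (bigD1 f) //=; congr (_ + _).
apply: eq_bigl => h; have [hC|//] := boolP (h \in C); rewrite /=.
apply/idP/idP => [hf|]; last by apply: contraNneq => ->.
apply: contraNN hf => hneg; apply/eqP.
exact: flow_negative_unique Cflow hC fC hneg fneg.
Qed.

Lemma half_weight_ge0 f : 0 <= half_weight f.
Proof. by rewrite /half_weight; case: ifP => // _; rewrite invr_ge0 ler0n. Qed.

Lemma half_weightS i : half_weight (S i) = 2^-1.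
Proof. by rewrite /half_weight codom_f. Qed.

Lemma missing_weight_ge0 f : 0 <= missing_weight f.
Proof. exact: bigmax_ge_id. Qed.

Lemma half_point_covering : covering_polyhedron (flow_clutter G) half_point.
Proof.
split=> [f|C Cflow].
  rewrite ffunE; case: ifP => _; [exact: missing_weight_ge0 | exact: half_weight_ge0].
have [_ /eqP/cards1P[f fE]] := Cflow.
have /setIP[fC] : f \in C :&: neg_edges G by rewrite fE set11.
rewrite inE => fneg; rewrite (sum_flow _ Cflow fC fneg) ffunE fneg.
under eq_bigr => h /andP[_ /negbTE hpos] do rewrite ffunE hpos.
rewrite -lerBlDr; apply: le_bigmax_cond.
by rewrite fC andbT; apply/asboolP.
Qed.

(** Two edges of weight 1/2 already cover any flow through [N c]. *)
Lemma missing_weightN c : missing_weight (N c) = 0.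
Proof.
apply/eqP; rewrite eq_le missing_weight_ge0 andbT.
apply: bigmax_le => // C /andP[/asboolP Cflow cC].
have [i [j [ij iC jC]]] := flow_two_edges Cflow cC.
rewrite subr_le0 (bigD1 (S i)) /=; last by rewrite iC g_neg.
rewrite (bigD1 (S j)) /=; last first.
  rewrite jC g_neg /=; apply: contraNneq ij => /g_inj[->] //.
rewrite !half_weightS addrA (_ : 2^-1 + 2^-1 = 1 :> R); last by lra.
by rewrite lerDl sumr_ge0 // => h _; apply: half_weight_ge0.
Qed.

Section Extreme.
Variable z : {ffun edge G -> R}.
Hypothesis zP : covering_polyhedron (flow_clutter G) z.
Hypothesis z_half : forall f, ~~ negative f -> z f = half_weight f.

(** Minimality, to be applied to both ends of a segment through [half_point]. *)
Lemma missing_weight_le f : negative f -> missing_weight f <= z f.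
Proof.
move=> fneg; apply: bigmax_le => [|C /andP[/asboolP Cflow fC]]; first exact: zP.1.
have := zP.2 C Cflow; rewrite (sum_flow _ Cflow fC fneg) -lerBlDr.
congr (_ <= _); congr (_ - _); apply: eq_bigr => h /andP[_ hpos].
exact: z_half.
Qed.

End Extreme.

(** Each step exchanges [a i] with [1 - a i], and a full turn has an odd number of steps. *)
Lemma odd_alternating (a : 'I_k -> R) :
  (forall i, a i + a (ordS i) = 1) -> forall i, a i = 2^-1.
Proof.
move=> aS i.
have alt r : a (iter r (@ordS k) i) = if odd r then 1 - a i else a i.
  elim: r => //= r IH; have := aS (iter r (@ordS k) i).
  by rewrite IH; case: (odd r) => /=; lra.
have := alt k; rewrite k_odd (_ : iter k _ i = i); first by lra.
by apply: ord_inj; rewrite iter_ordS modnDr modn_small.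
Qed.

(** The ends [y] and [z] of a segment must agree with the point first on its zeros, then on the
    edges [S i] by tight flows and oddness, finally on negative edges by minimality. *)
Lemma half_point_extreme n (v : nat -> vertex G) (e : nat -> edge G) :
  pos_cycle n v e -> extreme_point (covering_polyhedron (flow_clutter G)) half_point.
Proof.
move=> vP; split=> [|y z t yP zP /andP[t0 t1] xE]; first exact: half_point_covering.
have t'0 : 0 < 1 - t by rewrite subr_gt0.
have conv_min (a b c : R) : c <= a -> c <= b -> c = t * a + (1 - t) * b ->
    a = c /\ b = c.
  move=> ca cb E.
  have h : t * (a - c) + (1 - t) * (b - c) = 0 
    by apply: etrans (subrr c); rewrite [X in _ = X - _]E; ring.
  have ha : 0 <= t * (a - c) by rewrite mulr_ge0 ?subr_ge0 // ltW.
  have hb : 0 <= (1 - t) * (b - c) by rewrite mulr_ge0 ?subr_ge0 // ltW.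
  have /eqP : t * (a - c) = 0 by lra.
  have /eqP : (1 - t) * (b - c) = 0 by lra.
  rewrite !mulf_eq0 (gt_eqF t0) (gt_eqF t'0) !subr_eq0 => /eqP -> /eqP ->.
  by [].
have y_z0 f : half_point f = 0 -> y f = 0 /\ z f = 0.
  by move=> f0; apply: conv_min; rewrite -?f0 // f0; [exact: yP.1 | exact: zP.1].
(* On this flow [y] and [z] are supported by two edges of weight 1/2; both sums are at least 1 and a
   weighted mean of them is 1. *)
have pair c : y (S c) + y (S (ordS c)) = 1 /\ z (S c) + z (S (ordS c)) = 1.
  have [C [Cflow cC CS]] := tight_flow_exists c vP.
  have sumE (d : {ffun edge G -> R}) : (forall f, half_point f = 0 -> d f = 0) ->
      \sum_(f in C) d f = d (S c) + d (S (ordS c)).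
    move=> d0; rewrite (bigD1 (S c)) /=; last by rewrite CS eqxx.
    rewrite (bigD1 (S (ordS c))) /=; last first.
      rewrite CS eqxx orbT /=; apply/eqP => /g_inj[/eqP].
      by rewrite (negPf (@iter_ordS_neq k c 1 _)) //; lia.
    rewrite big1 ?addr0 // => f /andP[/andP[fC fc] fSc]; apply: d0.
    rewrite ffunE; have [fneg|fpos] := boolP (negative f).
      rewrite (flow_negative_unique Cflow fC cC fneg) ?g_neg //.
      exact: missing_weightN.
    rewrite /half_weight; case: ifP => // /codomP[i fE].
    by move: fC; rewrite fE CS => /orP[]/eqP iE;
      rewrite fE iE eqxx in fc fSc.
  have := zP.2 C Cflow; have := yP.2 C Cflow.
  rewrite !sumE //; try by move=> f /y_z0[].
  move=> y1 z1; apply: conv_min => //.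
  have := xE (S c); have := xE (S (ordS c)).
  rewrite !ffunE !g_neg /= !half_weightS.
  set a := y _; set b := z _; set a' := y _; set b' := z _.
  lra.
have yS := odd_alternating (fun c => (pair c).1).
have zS := odd_alternating (fun c => (pair c).2).
have pos f : ~~ negative f -> y f = half_weight f /\ z f = half_weight f.
  move=> fpos; have [|fN] := boolP (f \in codom (fun i : 'I_k => S i)).
    by move=> /codomP[i ->]; rewrite half_weightS yS zS.
  have w0 : half_weight f = 0 by rewrite /half_weight (negPf fN).
  by rewrite w0; apply: y_z0; rewrite ffunE (negPf fpos).
have all f : y f = half_point f /\ z f = half_point f.
  have [fneg|fpos] := boolP (negative f); last first.
    by rewrite ffunE (negPf fpos); apply: pos.
  apply: conv_min => //; rewrite ffunE fneg; apply: missing_weight_le => // h hpos.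
    exact: (pos h hpos).1.
  exact: (pos h hpos).2.
by split; apply/ffunP => f; case: (all f).
Qed.

Lemma half_point_not_ideal n (v : nat -> vertex G) (e : nat -> edge G) :
  pos_cycle n v e -> ~ ideal R (flow_clutter G).
Proof.
move=> vP /(_ _ (half_point_extreme vP)) int.
have i : 'I_k by exists 0%N; lia.
have := int (S i); rewrite ffunE g_neg /= half_weightS.
move=> /intrP[a aE].
have /eqP : (a * 2)%:~R = 1%:~R :> R by rewrite rmorphM /= -aE mulVf ?pnatr_eq0.
by rewrite eqr_int; lia.
Qed.

End HalfPoint.

(** * Transfer to strong minors and the equivalence *)

Lemma card_pos_flow_circuit k : #|pos_edges (flow_circuit k)| = k.
Proof.
rewrite (_ : pos_edges _ =
  [set (inl i : edge (flow_circuit k)) | i : 'I_k]).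
  by rewrite card_imset ?card_ord // => i j [].
apply/setP => -[i|i]; rewrite inE /=; apply/esym.
  by rewrite imset_f.
by apply/imsetP => -[].
Qed.

Lemma pos_circuit_card (G : sgraph) :
  pos_circuit G -> #|pos_edges G| = #|vertex G|.
Proof.
move=> [n [v [e [_ v_inj e_inj _ [VE ->]]]]].
by rewrite -(cardsT (vertex G)) VE !card_imset.
Qed.

(** Both [G] and the flow-circuit have as many positive edges as vertices, so the equality case of
    [strong_minor_partition] applies: no positive edge was deleted. *)
Lemma flow_circuit_partition (G : sgraph) k :
  pos_circuit G -> has_strong_minor G (flow_circuit k) ->
  exists (pi : vertex G -> 'I_k) (g : edge (flow_circuit k) -> edge G),
  [/\ injective g, forall c, negative (g c) = negative c,
      forall c, joins c (pi (ends (g c)).1) (pi (ends (g c)).2)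
    & forall f, ~~ negative f -> f \notin codom g ->
        pi (ends f).1 = pi (ends f).2].
Proof.
move=> Gpos [H GH [p [q [p_bij q_bij q_joins q_neg]]]].
have Gle : #|pos_edges G| <= #|vertex G| by rewrite pos_circuit_card.
have [pi [g [g_inj g_neg g_ends _ pi_const]]] := strong_minor_partition GH Gle.
have [q' qK q'K] := q_bij.
have cardV : #|vertex H| = k by rewrite (bij_eq_card p_bij) card_ord.
have cardE : #|pos_edges H| = k.
  rewrite -[RHS]card_pos_flow_circuit -(card_imset (mem (pos_edges H)) (bij_inj q_bij)).
  apply: eq_card => c; apply/imsetP/idP => [[f fpos ->]|cpos].
    by move: fpos; rewrite !inE q_neg.
  by exists (q' c); rewrite ?q'K // inE -q_neg q'K; rewrite inE in cpos.
exists (fun u => p (pi u)), (fun c => g (q' c)); split.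
- by move=> c c' /g_inj/(can_inj q'K).
- by move=> c; rewrite g_neg -q_neg q'K.
- move=> c; rewrite -{1}[c]q'K q_joins.
  by have := g_ends (q' c); rewrite /joins => ->; rewrite eqxx.
move=> f fpos fN; congr p; apply: pi_const => //; first by rewrite cardV cardE.
apply: contraNN fN => /codomP[h ->]; apply/codomP.
by exists (q h); rewrite qK.
Qed.

Lemma odd_flow_circuit_minor (G : sgraph) (n K w : nat) (v : nat -> vertex G)
    (e : nat -> edge G) (m : nat -> nat) :
  pos_cycle n v e -> 1 < w -> w.*2 < K -> coprime K w ->
  m 0 = 0 -> {homo m : i j / i <= j} -> (forall j, m (j + n) = m j + K) ->
  (forall q, exists f s t, [/\ negative f, joins f (v s) (v t),
     m s = q %[mod K] & m t = m s + w]) ->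
  exists k, [/\ odd k, 5 <= k & has_strong_minor G (flow_circuit k)].
Proof.
move=> vP w1 wK coKw m0 m_mono mD m_chord.
have [k [k_odd k5 Kk kK]] := odd_block_count w1 wK coKw.
have K0 : 0 < K by lia.
exists k; split=> //.
(* A circle with [K] marks is cut into [k] equal arcs; the vertex [v j] sits at mark [m j], and its
   block is the number of whole arcs before it. *)
apply: (@flow_circuit_minor G n v e vP k (fun j => m j * k %/ K)) => //.
- by rewrite m0 mul0n div0n.
- by move=> j; rewrite mD mulnDl mulnC [K * k]mulnC divnDMl // mulnC.
- by move=> i j ij; rewrite leq_div2r // leq_mul2r m_mono ?orbT.
move=> i; have [|q [qi qwi]] := @block_point K k w i _ Kk kK w1; first by lia.
have [f [s [t [fneg fj sq tE]]]] := m_chord q.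
exists f, s, t; split=> //; first by rewrite (modn_scale k K0 sq) qi.
by rewrite tE (@modn_scale K k _ (q + w)) ?qwi ?addn2 // -modnDml sq modnDml.
Qed.

Theorem theorem3 (R : realType) (G : sgraph) (hG : pos_circuit G) :
  ideal R (flow_clutter G) <->
  ~ (exists k : nat,
       [/\ (3 <= k)%N, odd k, (5 <= #|pos_edges (flow_circuit k)|)%N
         & has_strong_minor G (flow_circuit k)]).
Proof.
have [n [v [e vP]]] := pos_circuitP hG; split.
  move=> G_ideal [k [_ k_odd]]; rewrite card_pos_flow_circuit => k5 k_minor.
  have [pi [g [g_inj g_neg g_ends pi_const]]] := flow_circuit_partition hG k_minor.
  exact: (half_point_not_ideal k5 k_odd g_inj g_neg g_ends pi_const vP G_ideal).
move=> no_minor x x_ext.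
have [//|[K [w [m [[w1 wK coKw] m0 m_mono mD m_chord]]]]] := extreme_circulant vP x_ext.
case: no_minor.
have [k [k_odd k5 k_minor]] := odd_flow_circuit_minor vP w1 wK coKw m0 m_mono mD m_chord.
by exists k; rewrite card_pos_flow_circuit; split=> //; lia.
Qed.
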